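(* Let $A\in\mathbb{R}^{n_x\times n_x}$, $B\in\mathbb{R}^{n_x\times n_u}$, $B_w\in\mathbb{R}^{n_x\times n_w}$, $Q\in\mathbb{R}^{n_x\times n_x}$, $R\in\mathbb{R}^{n_u\times n_u}$ satisfy the standing assumptions given in the context, with full state measurement (i.e. $C=I_{n_x}$), and let $\mathcal{K}$ and $J:\mathcal{K}\to\mathbb{R}_+$ be the associated stabilizing set and $\mathcal{H}_\infty$ cost. Then, for every $K\in\mathcal{K}$, there exists a constant $\mu_K>0$ such that $$\mu_K\left(J(K)-J^\star\right)\le\mathrm{dist}(0,\partial J(K)),$$ where $\partial J(K)$ denotes the Clarke subdifferential of $J$ at $K$ and $J^\star=\min_{K\in\mathcal{K}}J(K)$.
   Context: Standing assumptions: $(A,B)$ is stabilizable; $B_w$ has full row rank; $Q$ and $R$ are (symmetric) positive definite; and the set of stabilizing static state-feedback gains $$\mathcal{K}:=\{K\in\mathbb{R}^{n_u\times n_x}\mid\rho(A+BK)<1\}$$ is nonempty, where $\rho(\cdot)$ denotes the spectral radius of a matrix. (This is the case $C=I_{n_x}$ of static output feedback $u_t=Ky_t$, $y_t=Cx_t$.) For $K\in\mathcal{K}$ and $\omega\in[0,2\pi]$, define the $(n_x+n_u)\times n_w$ complex matrix $$\mathbf{T}_{zw}(K,\omega)=\begin{bmatrix}Q^{1/2}\\ R^{1/2}K\end{bmatrix}\left(e^{j\omega}I-(A+BK)\right)^{-1}B_w,$$ with $j$ the imaginary unit, and the $\mathcal{H}_\infty$ cost $$J(K):=\|\mathbf{T}_{zw}(K)\|_{\mathcal{H}_\infty}=\max_{\omega\in[0,2\pi]}\sigma_{\max}(\mathbf{T}_{zw}(K,\omega)),$$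 where $\sigma_{\max}$ is the largest singular value. The space of gains carries the Frobenius norm and inner product, and $\mathrm{dist}(0,S)=\inf_{G\in S}\|G\|_F$. *)

(* Defs.v *)
(* Written over MathComp and MathComp-Analysis, with a generic [R : realType]
   as the real line and [R[i]] as the complex plane. *)
From HB Require Import structures.
From mathcomp Require Import all_boot all_order all_algebra.
From mathcomp Require Import spectral complex.
From mathcomp Require Import all_classical all_reals all_analysis.

Set Implicit Arguments.
Unset Strict Implicit.
Unset Printing Implicit Defensive.

Import Order.TTheory GRing.Theory Num.Theory.
Import numFieldNormedType.Exports.

Local Open Scope classical_set_scope.
Local Open Scope ring_scope.
Local Open Scope complex_scope.
Local Open Scope sesquilinear_scope.

Section MatrixNotions.
Context {R : realType}.

Definition complexify {m n : nat} (M : 'M[R]_(m, n)) : 'M[R[i]]_(m, n) :=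
  map_mx (real_complex R) M.

(* The spectrum is finite, so the supremum is a maximum; it is 0 for the empty
   0 x 0 matrix. *)
Definition spectral_radius {n : nat} (M : 'M[R]_n) : R :=
  sup [set ComplexField.Normc.normc l |
        l in [set l : R[i] | eigenvalue (complexify M) l]].

Definition singular_value {m n : nat} (M : 'M[R[i]]_(m, n)) (s : R) : Prop :=
  0 <= s /\ eigenvalue (M ^t* *m M) (s ^+ 2)%:C.

Definition sigma_max {m n : nat} (M : 'M[R[i]]_(m, n)) : R :=
  sup [set s | singular_value M s].

Definition posdefmx {n : nat} (M : 'M[R]_n) : Prop :=
  M^T = M /\ forall x : 'cV[R]_n, x != 0 -> 0 < (x^T *m M *m x) 0 0.

Definition possemidefmx {n : nat} (M : 'M[R]_n) : Prop :=
  M^T = M /\ forall x : 'cV[R]_n, 0 <= (x^T *m M *m x) 0 0.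

(* The principal square root M^{1/2}: the unique symmetric positive
   semidefinite S with S S = M when M is itself positive semidefinite; the
   default value 0 is only taken when there is no such S. *)
Definition sqrtmx {n : nat} (M : 'M[R]_n) : 'M[R]_n :=
  xget 0 [set S | possemidefmx S /\ S *m S = M].

Definition frob_inner {m n : nat} (U V : 'M[R]_(m, n)) : R := \tr (U^T *m V).

Definition frob_norm {m n : nat} (U : 'M[R]_(m, n)) : R :=
  Num.sqrt (frob_inner U U).

(* The infimum is taken in the extended reals, so that dist(0, set0) = +oo. *)
Definition frob_dist0 {m n : nat} (S : set 'M[R]_(m, n)) : \bar R :=
  ereal_inf [set (frob_norm G)%:E | G in S].

(* Clarke's generalized directional derivative
     limsup_{Y -> X, t -> 0+} (f (Y + t V) - f Y) / t.
   The library topology on matrices is that of the entrywise maximum norm,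
   hence the one of the Frobenius norm. Only the values of f near X matter:
   a function meaningful on an open set may be extended arbitrarily. *)
Definition clarke_derivative {m n : nat} (f : 'M[R]_(m, n) -> R)
    (X V : 'M[R]_(m, n)) : \bar R :=
  limf_esup (fun p : 'M[R]_(m, n) * R =>
               ((f (p.1 + p.2 *: V) - f p.1) / p.2)%:E)
            (filter_prod (nbhs X) 0^'+).

Definition clarke_subdifferential {m n : nat} (f : 'M[R]_(m, n) -> R)
    (X : 'M[R]_(m, n)) : set 'M[R]_(m, n) :=
  [set G | forall V, ((frob_inner G V)%:E <= clarke_derivative f X V)%E].

End MatrixNotions.

Section StateFeedback.
Context {R : realType} {nx nu nw : nat}.
Variables (A : 'M[R]_nx) (B : 'M[R]_(nx, nu)).

Definition stabilizing_gains : set 'M[R]_(nu, nx) :=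
  [set K | spectral_radius (A + B *m K) < 1].

Definition stabilizable : Prop :=
  exists F : 'M[R]_(nu, nx), spectral_radius (A + B *m F) < 1.

Variables (Bw : 'M[R]_(nx, nw)) (Q : 'M[R]_nx) (Ru : 'M[R]_nu).

Definition transfer_zw (K : 'M[R]_(nu, nx)) (w : R) :
    'M[R[i]]_(nx + nu, nw) :=
  complexify (col_mx (sqrtmx Q) (sqrtmx Ru *m K))
    *m invmx ((cos w +i* sin w)%:M - complexify (A + B *m K))
    *m complexify Bw.

(* For a stabilizing K the maximized function is continuous on [0, 2 pi], so
   the supremum is the maximum. For other K the value is meaningless. *)
Definition Hinf_cost (K : 'M[R]_(nu, nx)) : R :=
  sup [set sigma_max (transfer_zw K w) | w in `[0, 2 * pi]].

(* The cost is nonnegative and coercive on the stabilizing set, so the infimum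
   is the minimum under the assumptions of the theorem. *)
Definition Hinf_opt : R := inf [set Hinf_cost K | K in stabilizing_gains].

End StateFeedback.

(* Main.v *)
Require Import Defs.
From HB Require Import structures.
From mathcomp Require Import all_boot all_order all_algebra.
From mathcomp Require Import fingroup perm spectral complex.
From mathcomp Require Import ring lra.
From mathcomp Require Import all_classical all_reals all_analysis.

(** Why the theorem holds.

    The constant may depend on [K], so when [J K] is the optimal value there is
    nothing to prove, and otherwise it is enough to find one direction [V] along
    which Clarke's directional derivative of [J] at [K] is at most some [- c < 0]:
    every subgradient [G] then satisfies [<G, V> <= - c], hence
    [|G| >= c / (|V| + 1)] by Cauchy-Schwarz.

    The direction comes from the hidden convexity of state feedback. Let [g = J K]
    and let [Ks] be a stabilizing gain with [J Ks < g]. Write [F], [C] for the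
    closed-loop and output matrices at [K], [G] for the noise input matrix and [E]
    for the matrix from the input to the output. Two storage functions are used. The
    bounded real lemma ([bounded_real]), at [K] and at the exact level [g ^+ 2],
    gives a symmetric [P] with
      [|F x + G w|_P^2 + |C x|^2 - g^2 |w|^2 <= |x|_P^2];
    the same lemma for the transposed system at [Ks] gives [X >= 0] and a level
    [l < g^2] ([dual_storage]). The direction is [V = (Ks - K) X P].

    To see that it is a descent direction, take a frequency [z] and a steady state
    [z x = F x + G w] with [|w| = 1], and let [q] be the adjoint state,
    [q = F^T (z q) + C^T C x]. If the frequency and [w] attain the peak gain, the
    storage inequality is an equality at [(x, w)], so its gradient vanishes there:
    [q = P x] and [G^T (z q) = g^2 w]. The derivative
    of [|C x|^2] along [V] is [2 <h, V x>] with [h = B^T (z q) + E^T C x], and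
    completing a square in the storage inequality of [Ks] yields
      [2 <h, V x> = 2 <h, (Ks - K) X q>
        <= l |C x|^2 - |G^T (z q)|^2 = g^2 (l - g^2) < 0]. Away from the
    peak the two identities fail by at most a multiple of the square root of the gap
    [g^2 - |C x|^2] ([adjoint_storage]); this loss is absorbed by the gap itself
    ([descent_rate], [descent_budget]). All estimates are therefore uniform in the
    frequency and in the gains near [K], with no compactness argument and no
    continuity of [P] in [K] ([uniform_descent]).

    Complex vectors are avoided in these estimates: [a + i b] is the real matrix with
    columns [a] and [b], and multiplication by [z] is multiplication on the right by
    a rotation. A gain bound is stated for [x U = F x + G w] with [U] an arbitrary
    real orthogonal matrix ([gain]). Rotations give the frequency response, and
    cyclic shifts give periodic trajectories, so that the frequency-domain bound
    becomes, through the spectral theorem for [U], the time-domain inequality from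
    which the storage function is built. *)

Set Implicit Arguments.
Unset Strict Implicit.
Unset Printing Implicit Defensive.

Import Order.TTheory GRing.Theory Num.Theory.
Import numFieldNormedType.Exports.

Local Open Scope classical_set_scope.
Local Open Scope ring_scope.

Local Notation "⟪ x , y ⟫" := (frob_inner x y) (format "⟪ x ,  y ⟫").
Local Notation "⟦ x ⟧" := (frob_norm x) (format "⟦ x ⟧").

(** * Frobenius geometry of real matrices *)

Section Frobenius.
Context {R : realType}.

Lemma frob_innerE m n (x y : 'M[R]_(m, n)) :
  ⟪x, y⟫ = \sum_j \sum_i x i j * y i j.
Proof.
rewrite /frob_inner /mxtrace; apply: eq_bigr => j _.
by rewrite mxE; apply: eq_bigr => i _; rewrite mxE.
Qed.

Lemma frob_innerC m n (x y : 'M[R]_(m, n)) : ⟪x, y⟫ = ⟪y, x⟫.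
Proof.
by rewrite !frob_innerE; do 2 (apply: eq_bigr => ? _); rewrite mulrC.
Qed.

Lemma frob_innerDr m n (x y z : 'M[R]_(m, n)) : ⟪x, y + z⟫ = ⟪x, y⟫ + ⟪x, z⟫.
Proof. by rewrite /frob_inner mulmxDr raddfD. Qed.

Lemma frob_innerDl m n (x y z : 'M[R]_(m, n)) : ⟪x + y, z⟫ = ⟪x, z⟫ + ⟪y, z⟫.
Proof. by rewrite frob_innerC frob_innerDr !(frob_innerC z). Qed.

Lemma frob_innerZr m n a (x y : 'M[R]_(m, n)) : ⟪x, a *: y⟫ = a * ⟪x, y⟫.
Proof. by rewrite /frob_inner -scalemxAr mxtraceZ. Qed.

Lemma frob_innerZl m n a (x y : 'M[R]_(m, n)) : ⟪a *: x, y⟫ = a * ⟪x, y⟫.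
Proof. by rewrite frob_innerC frob_innerZr frob_innerC. Qed.

Lemma frob_innerNr m n (x y : 'M[R]_(m, n)) : ⟪x, (- y)⟫ = - ⟪x, y⟫.
Proof. by rewrite -scaleN1r frob_innerZr mulN1r. Qed.

Lemma frob_innerNl m n (x y : 'M[R]_(m, n)) : ⟪(- x), y⟫ = - ⟪x, y⟫.
Proof. by rewrite frob_innerC frob_innerNr frob_innerC. Qed.

Definition frob_innerL :=
  (frob_innerDl, frob_innerDr, frob_innerNl, frob_innerNr, frob_innerZl, frob_innerZr).

Lemma frob_inner_mull m n p (A : 'M[R]_(m, n)) (x : 'M[R]_(n, p)) y :
  ⟪A *m x, y⟫ = ⟪x, A^T *m y⟫.
Proof. by rewrite /frob_inner trmx_mul mulmxA. Qed.

Lemma frob_inner_mulr m n p (x : 'M[R]_(m, n)) (U : 'M[R]_(n, p)) y :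
  ⟪x *m U, y⟫ = ⟪x, y *m U^T⟫.
Proof. by rewrite /frob_inner trmx_mul -mulmxA mxtrace_mulC mulmxA. Qed.

Lemma frob_inner_col_mx m1 m2 n (x1 y1 : 'M[R]_(m1, n)) (x2 y2 : 'M[R]_(m2, n)) :
  ⟪col_mx x1 x2, col_mx y1 y2⟫ = ⟪x1, y1⟫ + ⟪x2, y2⟫.
Proof. by rewrite /frob_inner tr_col_mx mul_row_col raddfD. Qed.

Lemma frob_inner_ge0 m n (x : 'M[R]_(m, n)) : 0 <= ⟪x, x⟫.
Proof. by rewrite frob_innerE; do 2 (apply: sumr_ge0 => ? _); exact: sqr_ge0. Qed.

Lemma frob_normK m n (x : 'M[R]_(m, n)) : ⟦x⟧ ^+ 2 = ⟪x, x⟫.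
Proof. by rewrite sqr_sqrtr// frob_inner_ge0. Qed.

Lemma frob_norm_ge0 m n (x : 'M[R]_(m, n)) : 0 <= ⟦x⟧.
Proof. exact: sqrtr_ge0. Qed.

Lemma frob_norm0 m n : ⟦(0 : 'M[R]_(m, n))⟧ = 0.
Proof. by rewrite /frob_norm /frob_inner mulmx0 raddf0 sqrtr0. Qed.

Lemma frob_norm_eq0 m n (x : 'M[R]_(m, n)) : ⟦x⟧ = 0 -> x = 0.
Proof.
move=> /eqP; rewrite sqrtr_eq0 => x0.
have {x0} : ⟪x, x⟫ == 0 by rewrite eq_le x0 frob_inner_ge0.
rewrite frob_innerE psumr_eq0 => [/allP/= x0|j _]; last first.
  by apply: sumr_ge0 => i _; exact: sqr_ge0.
apply/matrixP => i j; have := x0 j; rewrite mem_index_enum => /(_ isT).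
rewrite psumr_eq0 => [/allP/(_ i)|k _]; last exact: sqr_ge0.
by rewrite mem_index_enum mulf_eq0 orbb mxE => /(_ isT)/eqP.
Qed.

Lemma frob_normZ m n a (x : 'M[R]_(m, n)) : ⟦a *: x⟧ = `|a| * ⟦x⟧.
Proof.
by rewrite /frob_norm !frob_innerL mulrA -expr2 sqrtrM ?sqr_ge0// sqrtr_sqr.
Qed.

Lemma frob_normN m n (x : 'M[R]_(m, n)) : ⟦- x⟧ = ⟦x⟧.
Proof. by rewrite -scaleN1r frob_normZ normrN1 mul1r. Qed.

Lemma frob_inner_le m n (x y : 'M[R]_(m, n)) : ⟪x, y⟫ <= ⟦x⟧ * ⟦y⟧.
Proof.
have [y0|y0] := eqVneq ⟦y⟧ 0.
  rewrite (frob_norm_eq0 y0) -(scale0r (0 : 'M[R]_(m,n))) frob_innerZr mul0r.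
  by rewrite scale0r frob_norm0 mulr0.
have y_gt0 : 0 < ⟦y⟧ by rewrite lt_def y0 frob_norm_ge0.
have := frob_inner_ge0 (⟦y⟧ *: x - ⟦x⟧ *: y).
rewrite !frob_innerL -!frob_normK (frob_innerC y x) => xy.
have [x0|x0] := eqVneq ⟦x⟧ 0.
  rewrite (frob_norm_eq0 x0) -(scale0r (0 : 'M[R]_(m,n))) frob_innerZl mul0r.
  by rewrite scale0r frob_norm0 mul0r.
have x_gt0 : 0 < ⟦x⟧ by rewrite lt_def x0 frob_norm_ge0.
have xy_gt0 := mulr_gt0 x_gt0 y_gt0.
rewrite -(ler_pM2l xy_gt0); nra.
Qed.

Lemma frob_inner_abs m n (x y : 'M[R]_(m, n)) : `|⟪x, y⟫| <= ⟦x⟧ * ⟦y⟧.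
Proof.
by rewrite ler_norml frob_inner_le andbT lerNl -frob_innerNl -(frob_normN x) frob_inner_le.
Qed.

Lemma frob_normD m n (x y : 'M[R]_(m, n)) : ⟦x + y⟧ <= ⟦x⟧ + ⟦y⟧.
Proof.
rewrite -ler_sqr ?nnegrE ?addr_ge0 ?frob_norm_ge0// frob_normK !frob_innerL.
by rewrite (frob_innerC y x) -!frob_normK; have := frob_inner_le x y; nra.
Qed.

Lemma frob_normB m n (x y : 'M[R]_(m, n)) : ⟦x - y⟧ <= ⟦x⟧ + ⟦y⟧.
Proof. by rewrite -(frob_normN y) frob_normD. Qed.

Lemma frob_norm_col m n (x : 'M[R]_(m, n)) : ⟦x⟧ ^+ 2 = \sum_j ⟦col j x⟧ ^+ 2.
Proof.
rewrite frob_normK frob_innerE; apply: eq_bigr => j _.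
by rewrite frob_normK frob_innerE big_ord1; apply: eq_bigr => i _; rewrite mxE.
Qed.

Lemma frob_inner_cols m n (x y : 'M[R]_(m, n)) :
  ⟪x, y⟫ = \sum_j ⟪col j x, col j y⟫.
Proof.
rewrite frob_innerE; apply: eq_bigr => j _.
by rewrite frob_innerE big_ord1; apply: eq_bigr => i _; rewrite !mxE.
Qed.

Lemma frob_norm_tr m n (x : 'M[R]_(m, n)) : ⟦x^T⟧ = ⟦x⟧.
Proof. by rewrite /frob_norm /frob_inner trmxK mxtrace_mulC. Qed.

Lemma frob_normM m n p (A : 'M[R]_(m, n)) (x : 'M[R]_(n, p)) :
  ⟦A *m x⟧ <= ⟦A⟧ * ⟦x⟧.
Proof.
rewrite -ler_sqr ?nnegrE ?mulr_ge0 ?frob_norm_ge0// exprMn.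
rewrite (frob_norm_col x) mulr_sumr frob_norm_col; apply: ler_sum => j _.
rewrite -(frob_norm_tr A) (frob_norm_col A^T) mulr_suml frob_normK frob_innerE big_ord1.
have -> : \sum_i (col j (A *m x)) i 0 * (col j (A *m x)) i 0 =
          \sum_i ⟪col i A^T, col j x⟫ ^+ 2.
  apply: eq_bigr => i _; rewrite -expr2; congr (_ ^+ 2).
  by rewrite frob_innerE big_ord1 !mxE; apply: eq_bigr => k _; rewrite !mxE.
apply: ler_sum => i _; rewrite -exprMn -real_normK ?num_real//.
by rewrite ler_sqr ?nnegrE ?mulr_ge0 ?frob_norm_ge0// frob_inner_abs.
Qed.

Lemma frob_normM_le m n p (A : 'M[R]_(m, n)) (x : 'M[R]_(n, p)) b :
  ⟦x⟧ <= b -> ⟦A *m x⟧ <= ⟦A⟧ * b.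
Proof.
by move=> xb; rewrite (le_trans (frob_normM _ _))// ler_wpM2l ?frob_norm_ge0.
Qed.

Definition orthogonalmx n (U : 'M[R]_n) := U^T *m U = 1%:M.

Lemma orthogonalmx_tr n (U : 'M[R]_n) : orthogonalmx U -> orthogonalmx U^T.
Proof. by rewrite /orthogonalmx trmxK => /mulmx1C. Qed.

Lemma orthogonalmxKr m n (U : 'M[R]_n) (x : 'M[R]_(m, n)) : orthogonalmx U -> x *m U *m U^T = x.
Proof. by move=> /orthogonalmx_tr; rewrite /orthogonalmx trmxK -mulmxA => ->; rewrite mulmx1. Qed.

Lemma orthogonalmxKl m n (U : 'M[R]_n) (x : 'M[R]_(m, n)) : orthogonalmx U -> x *m U^T *m U = x.
Proof. by rewrite /orthogonalmx -mulmxA => ->; rewrite mulmx1. Qed.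

Lemma frob_inner_ortho m n (U : 'M[R]_n) (x y : 'M[R]_(m, n)) :
  orthogonalmx U -> ⟪x *m U, y *m U⟫ = ⟪x, y⟫.
Proof. by move=> oU; rewrite frob_inner_mulr orthogonalmxKr. Qed.

Lemma frob_norm_ortho m n (U : 'M[R]_n) (x : 'M[R]_(m, n)) :
  orthogonalmx U -> ⟦x *m U⟧ = ⟦x⟧.
Proof. by move=> oU; rewrite /frob_norm frob_inner_ortho. Qed.

End Frobenius.

(** * Power decay of stable matrices *)

Section PowerDecay.
Context {R : realType}.
Local Notation C := R[i].
Local Notation normc := ComplexField.Normc.normc.

Lemma normc_ge0 (x : C) : 0 <= normc x.
Proof. by case: x => a b; exact: sqrtr_ge0. Qed.

#[local] Hint Resolve normc_ge0 : core.

(** Removing one factor [A - z] at a time: if [u k = A ^+ k (A v - z v)] decays like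
    [r ^+ k], then [a k = A ^+ k v] solves [a k.+1 = z a k + u k] with [|z| < r], and a
    first-order recursion driven by a decaying input decays at the same rate. *)
Lemma annihilated_decay n m (A : 'M[C]_n) (s : seq C) (r : R) (v : 'M[C]_(n, m)) :
  0 < r -> all (fun z => normc z < r) s ->
  foldl (fun u z => A *m u - z *: u) v s = 0 ->
  exists2 c, 0 <= c & forall k i j, normc ((A ^+ k *m v) i j) <= c * r ^+ k.
Proof.
move=> r0; elim: s v => [|z s IH] v /=.
  move=> _ ->; exists 0 => // k i j.
  by rewrite mulmx0 mxE ComplexField.Normc.normc0 mul0r.
move=> /andP[zr /IH{}IH] /IH[c c0 decay].
pose c' := c / (r - normc z) + \sum_i \sum_j normc (v i j).
have gap : 0 < r - normc z by rewrite subr_gt0.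
have sum_ge0 : 0 <= \sum_i \sum_j normc (v i j).
  by do 2 (apply: sumr_ge0 => ? _).
have c'0 : 0 <= c' by rewrite addr_ge0// divr_ge0// ltW.
have cc' : c <= c' * (r - normc z).
  by rewrite /c' mulrDl divfK ?(lt0r_neq0 gap)// lerDl mulr_ge0// ltW.
exists c' => // k i j; elim: k => [|k IHk].
  rewrite expr0 mul1mx expr0 mulr1.
  apply: (@le_trans _ _ (\sum_i \sum_j normc (v i j))); last first.
    by rewrite lerDr divr_ge0// ltW.
  rewrite (bigD1 i)//= (bigD1 j)//= -addrA lerDl.
  by rewrite addr_ge0 ?sumr_ge0// => *; rewrite ?sumr_ge0.
have -> : A ^+ k.+1 *m v = z *: (A ^+ k *m v) + A ^+ k *m (A *m v - z *: v).
  by rewrite mulmxBr -scalemxAr mulmxA exprSr -mulmxE addrC subrK.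
rewrite mxE [X in normc (X + _)]mxE.
apply: (le_trans (le_normcD _ _)).
rewrite ComplexField.Normc.normcM.
apply: (@le_trans _ _ (normc z * (c' * r ^+ k) + c * r ^+ k)).
  by rewrite lerD// ler_wpM2l.
rewrite mulrA -mulrDl exprS mulrA ler_wpM2r ?exprn_ge0 ?(ltW r0)//; lra.
Qed.

Lemma foldl_horner_mx n (A : 'M[C]_n.+1) m (v : 'M[C]_(n.+1, m)) (s : seq C) :
  foldl (fun u z => A *m u - z *: u) v s =
  horner_mx A (\prod_(z <- s) ('X - z%:P)) *m v.
Proof.
elim: s v => [|z s IH] v /=; first by rewrite big_nil rmorph1 mul1mx.
rewrite IH big_cons mulrC rmorphM/= -mulmxE -mulmxA.
by congr (_ *m _); rewrite rmorphB/= horner_mx_X horner_mx_C mulmxBl mul_scalar_mx.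
Qed.

Lemma eigenvalue_bounded n (A : 'M[C]_n) :
  exists c, forall z, eigenvalue A z -> normc z <= c.
Proof.
have [s chiE] := closed_field_poly_normal (char_poly A).
exists (\sum_(l <- s) normc l) => l Al.
have : l \in s.
  move: Al; rewrite eigenvalue_root_char chiE rootZ ?root_prod_XsubC//.
  by rewrite lead_coef_eq0 monic_neq0// char_poly_monic.
by move=> ls; rewrite (big_rem l)//= lerDl sumr_ge0.
Qed.

Lemma eigenvalue_le_spectral_radius n (A : 'M[R]_n) z :
  eigenvalue (complexify A) z -> normc z <= spectral_radius A.
Proof.
move=> Az; apply: sup_upper_bound; last by exists z.
split; first by exists (normc z), z.
have [c Ac] := eigenvalue_bounded (complexify A).
by exists c => _ [l/= /Ac ? <-].
Qed.

Definition power_stable n (A : 'M[R]_n) :=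
  exists c r, [/\ 0 <= c, 0 <= r, r < 1 & forall k, ⟦A ^+ k⟧ <= c * r ^+ k].

Lemma power_stable_tr n (A : 'M[R]_n) : power_stable A -> power_stable A^T.
Proof.
have trX k : (A^T) ^+ k = (A ^+ k)^T.
  elim: k => [|k IH]; first by rewrite !expr0 trmx1.
  by rewrite exprS IH exprSr -!mulmxE trmx_mul.
by move=> [c [r [c0 r0 r1 decay]]]; exists c, r; split=> // k; rewrite trX frob_norm_tr.
Qed.

(** By Cayley-Hamilton the identity matrix is annihilated by the product of the
    factors [A - z] over the eigenvalues [z]. *)
Lemma stable_power_decay n (A : 'M[R]_n) :
  spectral_radius A < 1 -> power_stable A.
Proof.
case: n A => [|n] A rhoA.
  exists 0, 0; split=> // k; rewrite mul0r.
  by rewrite (_ : A ^+ k = 0) ?frob_norm0//; apply/matrixP => -[].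
have [s chiE] := closed_field_poly_normal (char_poly (complexify A)).
have sub_radius l : l \in s -> normc l <= spectral_radius A.
  move=> ls; apply: eigenvalue_le_spectral_radius.
  rewrite eigenvalue_root_char chiE rootZ ?root_prod_XsubC//.
  by rewrite lead_coef_eq0 monic_neq0// char_poly_monic.
pose r := (Num.max 0 (spectral_radius A) + 1) / 2.
have r_gt0 : 0 < r by rewrite divr_gt0// ltr_wpDl// le_max lexx.
have max_lt1 : Num.max 0 (spectral_radius A) < 1 by rewrite gt_max ltr01.
have r_lt1 : r < 1 by rewrite /r; lra.
have rho_r : spectral_radius A < r.
  have : spectral_radius A <= Num.max 0 (spectral_radius A) by rewrite le_max lexx orbT.
  by rewrite /r; lra.
have small_s : all (fun z => normc z < r) s.
  by apply/allP => l /sub_radius; lra.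
have [|c c0 decay] := @annihilated_decay n.+1 n.+1 (complexify A) s r 1%:M r_gt0 small_s.
  rewrite foldl_horner_mx mulmx1.
  have := Cayley_Hamilton (complexify A); rewrite {1}chiE.
  by rewrite (monicP (char_poly_monic _)) scale1r.
exists (c * n.+1%:R), r; split=> //; [by rewrite mulr_ge0|exact: ltW|] => k.
rewrite -ler_sqr ?nnegrE ?frob_norm_ge0 ?mulr_ge0 ?exprn_ge0 ?(ltW r_gt0)//.
rewrite frob_normK frob_innerE.
have entry i j : (A ^+ k) i j * (A ^+ k) i j <= (c * r ^+ k) ^+ 2.
  have := decay k i j; rewrite mulmx1 /complexify -rmorphXn mxE /= expr0n /= addr0 sqrtr_sqr.
  move=> Akij; rewrite -expr2 -real_normK ?num_real// ler_sqr ?nnegrE//.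
  by rewrite mulr_ge0// exprn_ge0// ltW.
apply: (@le_trans _ _ (\sum_(j < n.+1) \sum_(i < n.+1) (c * r ^+ k) ^+ 2)).
  by do 2 (apply: ler_sum => ? _); exact: entry.
rewrite !sumr_const !card_ord -mulrnA -[leLHS]mulr_natl natrM.
by move: (n.+1%:R : R) => N; rewrite [leRHS](_ : _ = N * N * (c * r ^+ k) ^+ 2)//; ring.
Qed.

End PowerDecay.

(** * Resolvents and gains *)

Section Resolvent.
Context {R : realType}.

(** For [U] a rotation this bounds [(z - A)^-1] at a point [z] of the unit circle;
    quantifying over all orthogonal [U] makes the bound uniform in the frequency. *)
Definition resolvent_bound n (A : 'M[R]_n) (M : R) : Prop :=
  0 <= M /\ forall m (U : 'M[R]_m) (x b : 'M[R]_(n, m)),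
    orthogonalmx U -> x *m U = A *m x + b -> ⟦x⟧ <= M * ⟦b⟧.

Lemma le_geometric_tail (r d e y : R) : 0 <= r -> r < 1 ->
  (forall k, y <= d * r ^+ k + e) -> y <= e.
Proof.
move=> r0 r1 le_tail; apply/ler_addgt0Pl => _/posnumP[eps].
have /cvgrPdist_lt/(_ eps%:num ltac:(by [])) [N _ small] : geometric d r @ \oo --> 0.
  by apply: cvg_geometric; rewrite ger0_norm.
have := small N (leqnn N); rewrite sub0r normrN => /ltW/(le_trans (ler_norm _)).
by have := le_tail N; rewrite /geometric/=; lra.
Qed.

(** Unrolling [x = (A x + b) U^T] expresses [x] by the powers of [A] applied to [b],
    plus a remainder [A ^+ k x] that tends to zero. *)
Lemma stable_resolvent n (A : 'M[R]_n) : spectral_radius A < 1 ->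
  exists M, resolvent_bound A M.
Proof.
move=> /stable_power_decay[c [r [c0 r0 r1 decay]]].
have gap : 0 < 1 - r by rewrite subr_gt0.
exists (c / (1 - r)); split=> [|m U x b oU xE]; first by rewrite divr_ge0// ltW.
have step k : ⟦A ^+ k *m x⟧ <= ⟦A ^+ k.+1 *m x⟧ + c * r ^+ k * ⟦b⟧.
  rewrite -(frob_norm_ortho (A ^+ k *m x) oU) -mulmxA xE mulmxDr mulmxA.
  rewrite exprSr -mulmxE (le_trans (frob_normD _ _))// lerD2l.
  by rewrite (le_trans (frob_normM _ _))// ler_wpM2r ?frob_norm_ge0.
have tele k : ⟦x⟧ <= ⟦A ^+ k *m x⟧ + c / (1 - r) * (1 - r ^+ k) * ⟦b⟧.
  elim: k => [|k IH]; first by rewrite !expr0 mul1mx subrr mulr0 mul0r addr0.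
  rewrite (le_trans IH)//.
  apply: le_trans (_ : _ <= ⟦A ^+ k.+1 *m x⟧ + c * r ^+ k * ⟦b⟧ +
     c / (1 - r) * (1 - r ^+ k) * ⟦b⟧) _; first by rewrite lerD2r step.
  rewrite -addrA lerD2l exprS le_eqVlt; apply/orP; left; apply/eqP.
  by field; rewrite subr_eq0 gt_eqF.
apply: (@le_geometric_tail r (c * ⟦x⟧)) => // k.
rewrite (le_trans (tele k))// lerD//.
  rewrite (le_trans (frob_normM _ _))// -mulrA (mulrC ⟦x⟧) mulrA.
  by rewrite ler_wpM2r ?frob_norm_ge0.
rewrite ler_wpM2r ?frob_norm_ge0// ler_piMr ?divr_ge0 ?(ltW gap)//.
by rewrite gerBl exprn_ge0.
Qed.

Lemma resolvent_perturb n (A D : 'M[R]_n) M : resolvent_bound A M ->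
  M * ⟦D⟧ <= 1 / 2 -> resolvent_bound (A + D) (2 * M).
Proof.
move=> [M0 resA] MD; split=> [|m U x b oU]; first by rewrite mulr_ge0.
rewrite mulmxDl -addrA => /(resA _ _ _ _ oU) xle.
have : M * ⟦D *m x + b⟧ <= M * (⟦D⟧ * ⟦x⟧ + ⟦b⟧).
  by rewrite ler_wpM2l// (le_trans (frob_normD _ _))// lerD2r frob_normM.
have : M * ⟦D⟧ * ⟦x⟧ <= 1 / 2 * ⟦x⟧ by rewrite ler_wpM2r ?frob_norm_ge0.
lra.
Qed.

(** The bound makes the linear map [x |-> x U - A x] injective, hence onto. *)
Lemma resolvent_solve n (A : 'M[R]_n) M m (U : 'M[R]_m) (b : 'M[R]_(n, m)) :
  resolvent_bound A M -> orthogonalmx U -> exists x, x *m U = A *m x + b.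
Proof.
move=> [M0 resA] oU; pose G := lin_mx (mulmxr U) - lin_mx (mulmx A).
have GE x : mxvec x *m G = mxvec (x *m U - A *m x).
  by rewrite mulmxBr !mul_vec_lin raddfB.
have unitG : G \in unitmx.
  rewrite -row_free_unit; apply: inj_row_free => v vG0.
  have /eqP : vec_mx v *m U - A *m vec_mx v = 0.
    by apply: (can_inj mxvecK); rewrite -GE vec_mxK vG0 raddf0.
  rewrite subr_eq0 => /eqP; rewrite -[A *m _]addr0 => /(resA _ _ _ _ oU).
  rewrite frob_norm0 mulr0 => v0.
  have /frob_norm_eq0 v00 : ⟦vec_mx v⟧ = 0 by apply/eqP; rewrite eq_le v0 frob_norm_ge0.
  by rewrite -[v]vec_mxK v00 raddf0.
exists (vec_mx (mxvec b *m invmx G)).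
apply/eqP; rewrite addrC -subr_eq; apply/eqP/(can_inj mxvecK).
by rewrite -GE vec_mxK mulmxKV.
Qed.

(** [l] bounds the squared gain of the system with state matrix [A], input matrix [B]
    and output matrix [C]: of its frequency response when [U] is a rotation, of its
    periodic trajectories when [U] is a cyclic shift. *)
Definition gain n p q (A : 'M[R]_n) (B : 'M[R]_(n, p)) (C : 'M[R]_(q, n)) (l : R) :=
  forall m (U : 'M[R]_m) (x : 'M[R]_(n, m)) (w : 'M[R]_(p, m)),
    orthogonalmx U -> x *m U = A *m x + B *m w -> ⟦C *m x⟧ ^+ 2 <= l * ⟦w⟧ ^+ 2.

(** A matrix and its transpose have the same operator norm: pair the output [w] of
    the transposed system with the response of the original system to [w] itself. *)
Lemma gain_tr n p q (A : 'M[R]_n) (B : 'M[R]_(n, p)) (C : 'M[R]_(q, n)) M l :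
  resolvent_bound A M -> 0 <= l -> gain A B C l -> gain A^T C^T B^T l.
Proof.
move=> resA l0 gainABC m U y v oU yE; set w := B^T *m y.
have [x xE] := resolvent_solve (B *m w) resA (orthogonalmx_tr oU).
have wE : ⟦w⟧ ^+ 2 = ⟪v, C *m x⟫.
  rewrite frob_normK {1}/w frob_inner_mull trmxK.
  have -> : B *m w = x *m U^T - A *m x by rewrite xE addrC addKr.
  rewrite frob_innerDr frob_innerNr -frob_inner_mulr yE frob_innerDl.
  by rewrite frob_inner_mull trmxK addrC addKr frob_inner_mull trmxK.
have := gainABC _ _ _ _ (orthogonalmx_tr oU) xE.
have := frob_inner_le v (C *m x); rewrite -wE.
have [w0|w0] := eqVneq ⟦w⟧ 0.
  by move=> _ _; rewrite w0 expr0n mulr_ge0// sqr_ge0.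
have w_gt0 : 0 < ⟦w⟧ ^+ 2 by rewrite exprn_gt0// lt_def w0 frob_norm_ge0.
move=> le1 le2; rewrite -(ler_pM2r w_gt0).
have : (⟦w⟧ ^+ 2) ^+ 2 <= (⟦v⟧ * ⟦C *m x⟧) ^+ 2.
  by rewrite ler_sqr ?nnegrE ?sqr_ge0// mulr_ge0 ?frob_norm_ge0.
have : ⟦v⟧ ^+ 2 * ⟦C *m x⟧ ^+ 2 <= ⟦v⟧ ^+ 2 * (l * ⟦w⟧ ^+ 2).
  by rewrite ler_wpM2l ?sqr_ge0.
rewrite exprMn; lra.
Qed.

(** A resolvent bound is a gain bound with identity input and output. *)
Lemma resolvent_bound_tr n (A : 'M[R]_n) M :
  resolvent_bound A M -> resolvent_bound A^T M.
Proof.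
move=> resA; have [M0 resAE] := resA; split=> // m U x b oU xE.
have gA : gain A 1%:M 1%:M (M ^+ 2).
  move=> m' U' x' w' oU'; rewrite !mul1mx => /(resAE _ _ _ _ oU').
  by rewrite -exprMn ler_sqr ?nnegrE ?mulr_ge0 ?frob_norm_ge0.
have := gain_tr resA (sqr_ge0 M) gA.
move=> /(_ m U x b oU); rewrite !trmx1 !mul1mx => /(_ xE).
by rewrite -exprMn ler_sqr ?nnegrE ?mulr_ge0 ?frob_norm_ge0.
Qed.

End Resolvent.

(** * Singular values of complex matrices *)

Section SingularValues.
Context {R : realType}.
Local Notation C := R[i].
Local Notation normc := ComplexField.Normc.normc.
Local Open Scope sesquilinear_scope.

Definition cfrob_sq m n (v : 'M[C]_(m, n)) : R :=
  \sum_j \sum_i ((complex.Re (v i j)) ^+ 2 + (complex.Im (v i j)) ^+ 2).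

Lemma cfrob_sqE m n (v : 'M[C]_(m, n)) : (cfrob_sq v)%:C%C = \tr (v ^t* *m v).
Proof.
rewrite /cfrob_sq /mxtrace raddf_sum; apply: eq_bigr => j _.
rewrite mxE raddf_sum; apply: eq_bigr => i _.
by rewrite /= add_Re2_Im2 normCK !mxE mulrC.
Qed.

Lemma cfrob_sq_ge0 m n (v : 'M[C]_(m, n)) : 0 <= cfrob_sq v.
Proof. by do 2 (apply: sumr_ge0 => ? _); rewrite addr_ge0 ?sqr_ge0. Qed.

Lemma cfrob_sq_eq m n p q (v : 'M[C]_(m, n)) (w : 'M[C]_(p, q)) :
  \tr (v ^t* *m v) = \tr (w ^t* *m w) -> cfrob_sq v = cfrob_sq w.
Proof. by move=> vw; apply: (@complexI R); rewrite !cfrob_sqE. Qed.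

Lemma cfrob_sq_mulr_unitary m n (v : 'M[C]_(m, n)) (P : 'M[C]_n) :
  P \is unitarymx -> cfrob_sq (v *m P) = cfrob_sq v.
Proof.
move=> /unitarymxP PP; apply: cfrob_sq_eq.
rewrite trmx_mul map_mxM mxtrace_mulC -mulmxA (mulmxA P) PP mul1mx.
by rewrite mxtrace_mulC.
Qed.

Lemma cfrob_sq_mull_unitary m n (P : 'M[C]_m) (v : 'M[C]_(m, n)) :
  P \is unitarymx -> cfrob_sq (P *m v) = cfrob_sq v.
Proof.
move=> /unitarymxP/mulmx1C PP; apply: cfrob_sq_eq.
by rewrite trmx_mul map_mxM -mulmxA (mulmxA (P ^t*)) PP mul1mx.
Qed.

Lemma cfrob_sq_complexify m n (X : 'M[R]_(m, n)) : cfrob_sq (complexify X) = ⟦X⟧ ^+ 2.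
Proof.
rewrite frob_normK frob_innerE; do 2 (apply: eq_bigr => ? _).
by rewrite mxE /= expr0n addr0 expr2.
Qed.

Lemma cfrob_sq_cols m n (v : 'M[C]_(m, n)) : cfrob_sq v = \sum_j cfrob_sq (col j v).
Proof.
by apply: eq_bigr => j _; rewrite /cfrob_sq big_ord1; apply: eq_bigr => i _; rewrite mxE.
Qed.

Lemma cfrob_sqZ m n z (v : 'M[C]_(m, n)) : cfrob_sq (z *: v) = normc z ^+ 2 * cfrob_sq v.
Proof.
rewrite /cfrob_sq mulr_sumr; apply: eq_bigr => j _; rewrite mulr_sumr; apply: eq_bigr => i _.
rewrite mxE; case: z => a b; case: (v i j) => c d /=.
by rewrite sqr_sqrtr ?addr_ge0 ?sqr_ge0//; ring.
Qed.

Lemma cfrob_sq_eq0 m n (v : 'M[C]_(m, n)) : cfrob_sq v = 0 -> v = 0.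
Proof.
have ge0 i j : 0 <= complex.Re (v i j) ^+ 2 + complex.Im (v i j) ^+ 2.
  by rewrite addr_ge0 ?sqr_ge0.
move=> /eqP; rewrite psumr_eq0 => [/allP v0|j _]; last by rewrite sumr_ge0.
apply/matrixP => i j; rewrite mxE.
have := v0 j; rewrite mem_index_enum => /(_ isT); rewrite psumr_eq0// => /allP/(_ i).
rewrite mem_index_enum => /(_ isT); rewrite /= paddr_eq0 ?sqr_ge0// !sqrf_eq0.
by case: (v i j) => a b /= /andP[/eqP-> /eqP->].
Qed.

Lemma singular_value_le m n (M : 'M[C]_(m, n)) s (c : R) :
  singular_value M s -> (forall w : 'cV[C]_n, cfrob_sq (M *m w) <= c * cfrob_sq w) ->
  s ^+ 2 <= c.
Proof.
move=> [s0 /eigenvalueP[v vE v0]] Mc.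
have := Mc (v ^t*); have -> : cfrob_sq (M *m v ^t*) = s ^+ 2 * cfrob_sq (v ^t*).
  apply: (@complexI R); rewrite rmorphM/= !cfrob_sqE trmxCK trmx_mul map_mxM trmxCK.
  by rewrite mulmxA -(mulmxA v) vE -scalemxAl mxtraceZ.
rewrite ler_pM2r// lt_def cfrob_sq_ge0 andbT; apply: contra_neq v0 => /cfrob_sq_eq0 v0.
by rewrite -[v]trmxCK v0 trmx0 map_mx0.
Qed.

Lemma sup_nonneg (E : set R) : (forall x, E x -> 0 <= x) -> 0 <= sup E.
Proof.
move=> E0; have [[[x Ex] ubE]|noE] := pselect (has_sup E); last by rewrite sup_out.
by rewrite (le_trans (E0 _ Ex))// ub_le_sup.
Qed.

Lemma sup_le_nonneg (E : set R) g : 0 <= g -> ubound E g -> sup E <= g.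
Proof.
move=> g0 Eg; have [->|/set0P E0] := eqVneq E set0; first by rewrite sup0.
exact: ge_sup.
Qed.

Lemma sigma_max_ge0 m n (M : 'M[C]_(m, n)) : 0 <= sigma_max M.
Proof. by apply: sup_nonneg => s []. Qed.

Lemma sigma_max_le m n (M : 'M[C]_(m, n)) (g : R) : 0 <= g ->
  (forall w : 'cV[C]_n, cfrob_sq (M *m w) <= g ^+ 2 * cfrob_sq w) -> sigma_max M <= g.
Proof.
move=> g0 Mg; apply: sup_le_nonneg => // s sM; have := singular_value_le sM Mg.
by case: sM => s0 _; rewrite ler_sqr.
Qed.

(** Diagonalize [M^* M] in an orthonormal basis: each diagonal entry is the square of
    a singular value, hence at most [sigma_max M ^+ 2]. *)
Lemma sigma_max_bound m n (M : 'M[C]_(m, n)) (w : 'cV[C]_n) :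
  cfrob_sq (M *m w) <= sigma_max M ^+ 2 * cfrob_sq w.
Proof.
set N := M ^t* *m M.
have trN p (v : 'M[C]_(n, p)) : \tr (v ^t* *m N *m v) = (cfrob_sq (M *m v))%:C%C.
  by rewrite cfrob_sqE trmx_mul map_mxM !mulmxA.
have /orthomx_spectralP NE : N \is normalmx.
  by apply/normalmxP; rewrite /N trmx_mul map_mxM trmxCK.
set P := spectralmx N in NE; set d := spectral_diag N in NE.
have uP : P \is unitarymx := spectral_unitarymx N.
have Pu : P \in unitmx := spectral_unit N.
have PN : P *m N = diag_mx d *m P by rewrite {1}NE -!mulmxA mulKVmx.
have rowN k : row k P *m N = d 0 k *: row k P.
  by rewrite -row_mul PN row_mul row_diag_mx -scalemxAl -rowE.
have row_unit k : row k P *m (row k P) ^t* = 1%:M.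
  have /unitarymxP/matrixP/(_ k k) := uP; rewrite !mxE eqxx => PPkk.
  apply/matrixP => i j; rewrite !ord1 [RHS]mxE -[RHS]PPkk mxE.
  by apply: eq_bigr => l _; rewrite !mxE.
have dE k : d 0 k = (cfrob_sq (M *m (row k P) ^t*))%:C%C.
  by rewrite -trN trmxCK rowN -scalemxAl row_unit mxtraceZ mxtrace1 mulr1.
have dle k : cfrob_sq (M *m (row k P) ^t*) <= sigma_max M ^+ 2.
  set c := cfrob_sq _; have c0 : 0 <= c by exact: cfrob_sq_ge0.
  have sc : singular_value M (Num.sqrt c).
    split; first exact: sqrtr_ge0.
    rewrite sqr_sqrtr//; apply/eigenvalueP; exists (row k P); first by rewrite rowN dE.
    apply/negP => /eqP rk0; have := row_unit k; rewrite rk0 mul0mx => /matrixP/(_ 0 0).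
    by rewrite !mxE => /esym/eqP; rewrite oner_eq0.
  rewrite -(sqr_sqrtr c0) ler_sqr ?nnegrE ?sqrtr_ge0 ?sigma_max_ge0//.
  apply: ub_le_sup => //.
  have [e eb] := eigenvalue_bounded N; exists (1 + e) => s [s0 /eb].
  rewrite /= expr0n addr0 sqrtr_sqr ger0_norm ?sqr_ge0//.
  by have := sqr_ge0 (s - 1); nra.
rewrite -(cfrob_sq_mull_unitary w uP); set y := P *m w.
have -> : cfrob_sq (M *m w) =
    \sum_k cfrob_sq (M *m (row k P) ^t*) *
      (complex.Re (y k 0) ^+ 2 + complex.Im (y k 0) ^+ 2).
  apply: (@complexI R); rewrite -trN NE invmx_unitary//.
  have -> : w ^t* *m (P ^t* *m diag_mx d *m P) *m w = y ^t* *m diag_mx d *m y.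
    by rewrite /y trmx_mul map_mxM !mulmxA.
  rewrite mul_mx_diag /mxtrace big_ord1 mxE raddf_sum; apply: eq_bigr => k _.
  rewrite /= rmorphM/= add_Re2_Im2 normCK -dE !mxE; ring.
rewrite [cfrob_sq y]big_ord1 mulr_sumr; apply: ler_sum => k _.
by rewrite ler_wpM2r ?addr_ge0 ?sqr_ge0.
Qed.

End SingularValues.

(** * Complex frequencies as orthogonal matrices *)

Section ComplexGain.
Context {R : realType}.
Local Notation C := R[i].
Local Notation normc := ComplexField.Normc.normc.
Local Open Scope sesquilinear_scope.

Definition complex_gain n p q (A : 'M[R]_n) (B : 'M[R]_(n, p)) (D : 'M[R]_(q, n)) (l : R) :=
  forall z (x : 'cV[C]_n) (w : 'cV[C]_p), normc z = 1 ->
    z *: x = complexify A *m x + complexify B *m w ->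
    cfrob_sq (complexify D *m x) <= l * cfrob_sq w.

Lemma complexifyM m n p (X : 'M[R]_(m, n)) (Y : 'M[R]_(n, p)) :
  complexify (X *m Y) = complexify X *m complexify Y.
Proof. exact: map_mxM. Qed.

Lemma complexify_adjoint m n (X : 'M[R]_(m, n)) :
  (complexify X) ^t* = complexify X^T.
Proof. by apply/matrixP => i j; rewrite !mxE; exact: conjc_real. Qed.

Lemma orthogonal_unitary n (U : 'M[R]_n) :
  orthogonalmx U -> complexify U \is unitarymx.
Proof.
move=> /mulmx1C oU; apply/unitarymxP.
by rewrite complexify_adjoint -complexifyM oU /complexify map_mx1.
Qed.

Lemma col_mulmx (T : nzRingType) m n p k (X : 'M[T]_(m, n)) (Y : 'M[T]_(n, p)) :
  col k (X *m Y) = X *m col k Y.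
Proof. by rewrite !colE mulmxA. Qed.

(** Diagonalizing [U] over the complex numbers splits [x U = A x + B w] into one
    equation [z x = A x + B w] per eigenvalue [z], and [|z| = 1]; this is Parseval's
    identity when [U] is a cyclic shift. *)
Lemma gain_of_complex_gain n p q (A : 'M[R]_n) (B : 'M[R]_(n, p)) (D : 'M[R]_(q, n)) (l : R) :
  complex_gain A B D l -> gain A B D l.
Proof.
move=> gABD m U x w oU xU.
have uU := orthogonal_unitary oU; set V := complexify U in uU.
have /orthomx_spectralP VE : V \is normalmx.
  by apply/normalmxP; rewrite (unitarymxP uU) (mulmx1C (unitarymxP uU)).
set P := spectralmx V in VE; set d := spectral_diag V in VE.
have uP : P \is unitarymx := spectral_unitarymx V.
have uPt : P ^t* \is unitarymx by rewrite trmxC_unitary.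
have dE : diag_mx d = P *m V *m P ^t*.
  by rewrite VE invmx_unitary// !mulmxA (unitarymxP uP) mul1mx -mulmxA (unitarymxP uP) mulmx1.
have d1 k : normc (d 0 k) = 1.
  have : cfrob_sq (row k (diag_mx d)) = cfrob_sq (row k (1%:M : 'M[C]_m)).
    rewrite -(unitarymxP uP) dE -mulmxA !row_mul.
    by rewrite mulmxA !cfrob_sq_mulr_unitary.
  rewrite row_diag_mx cfrob_sqZ row1 (_ : cfrob_sq _ = 1) ?mulr1 => [/eqP|].
    by rewrite sqrp_eq1 => [/eqP//|]; exact: normc_ge0.
  rewrite /cfrob_sq (bigD1 k)//= big_ord1 big1 => [|j jk].
    by rewrite !mxE !eqxx /= expr1n expr0n !addr0.
  by rewrite big_ord1 !mxE (negbTE jk) andbF /= expr0n addr0.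
pose x' := complexify x *m P ^t*; pose w' := complexify w *m P ^t*.
have x'E : x' *m diag_mx d = complexify A *m x' + complexify B *m w'.
  rewrite !mulmxA -!complexifyM -mulmxDl /x' dE !mulmxA.
  rewrite -(mulmxA _ _ P) (mulmx1C (unitarymxP uP)) mulmx1 -complexifyM xU.
  by rewrite /complexify map_mxD.
have colE k : d 0 k *: col k x' = complexify A *m col k x' + complexify B *m col k w'.
  rewrite -!col_mulmx -raddfD -x'E; apply/matrixP => i j.
  by rewrite mul_mx_diag !mxE mulrC.
have -> : ⟦D *m x⟧ ^+ 2 = \sum_k cfrob_sq (complexify D *m col k x').
  rewrite -cfrob_sq_complexify complexifyM -(cfrob_sq_mulr_unitary _ uPt) -mulmxA cfrob_sq_cols.
  by apply: eq_bigr => k _; rewrite col_mulmx.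
have -> : ⟦w⟧ ^+ 2 = \sum_k cfrob_sq (col k w').
  by rewrite -cfrob_sq_complexify -(cfrob_sq_mulr_unitary _ uPt) cfrob_sq_cols.
rewrite mulr_sumr; apply: ler_sum => k _; exact: gABD (d1 k) (colE k).
Qed.

Definition reim n (x : 'cV[C]_n) : 'M[R]_(n, 2) :=
  \matrix_(i, j) if j == 0 then complex.Re (x i 0) else complex.Im (x i 0).

(** Multiplication by [z] read through [reim], see [reimZ]. *)
Definition rotation_mx (z : C) : 'M[R]_2 :=
  \matrix_(i, j) if i == 0 then (if j == 0 then complex.Re z else complex.Im z)
                 else (if j == 0 then - complex.Im z else complex.Re z).

Lemma reimD n (x y : 'cV[C]_n) : reim (x + y) = reim x + reim y.
Proof. by apply/matrixP => i j; rewrite !mxE; case: (j == 0); rewrite raddfD. Qed.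

Lemma reimZ n z (x : 'cV[C]_n) : reim (z *: x) = reim x *m rotation_mx z.
Proof.
apply/matrixP => i j; rewrite !mxE !big_ord_recl big_ord0 !mxE /=.
by case: (j == 0); case: z => a b; case: (x i 0) => c d /=; ring.
Qed.

Lemma reim_mul m n (X : 'M[R]_(m, n)) (x : 'cV[C]_n) :
  reim (complexify X *m x) = X *m reim x.
Proof.
apply/matrixP => i j; rewrite !mxE; case j0 : (j == 0); rewrite raddf_sum;
  by apply: eq_bigr => k _; rewrite !mxE j0; case: (x k 0) => a b /=; ring.
Qed.

Lemma cfrob_sq_reim n (x : 'cV[C]_n) : cfrob_sq x = ⟦reim x⟧ ^+ 2.
Proof.
rewrite frob_normK frob_innerE /cfrob_sq !big_ord_recl !big_ord0 !addr0 -big_split/=.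
by apply: eq_bigr => i _; rewrite !mxE /= !expr2.
Qed.

Lemma rotation_mx_orthogonal z : normc z = 1 -> orthogonalmx (rotation_mx z).
Proof.
case: z => a b /= /(congr1 (fun t => t ^+ 2)); rewrite expr1n sqr_sqrtr ?addr_ge0 ?sqr_ge0// => ab.
apply/matrixP => i j; rewrite !mxE !big_ord_recl big_ord0 !mxE /=.
case: (unliftP 0 i) => [i'|] ->; case: (unliftP 0 j) => [j'|] ->;
  rewrite ?ord1 /= ?eqxx -1?[RHS]ab; try ring.
Qed.

Lemma complex_gain_of_gain n p q (A : 'M[R]_n) (B : 'M[R]_(n, p)) (D : 'M[R]_(q, n)) (l : R) :
  gain A B D l -> complex_gain A B D l.
Proof.
move=> gABD z x w z1 zx; rewrite !cfrob_sq_reim reim_mul.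
apply: (gABD _ _ _ _ (rotation_mx_orthogonal z1)).
by rewrite -reimZ zx reimD !reim_mul.
Qed.

Lemma resolvent_unitmx n (A : 'M[R]_n) M z : resolvent_bound A M ->
  normc z = 1 -> z%:M - complexify A \in unitmx.
Proof.
move=> [_ resA] z1; rewrite -unitmx_tr -row_free_unit; apply: inj_row_free => v.
move=> /(congr1 trmx); rewrite trmx_mul !trmxK trmx0 mulmxBl mul_scalar_mx => /eqP.
rewrite subr_eq0 => /eqP zv.
have /(resA _ _ _ _ (rotation_mx_orthogonal z1)) : reim v^T *m rotation_mx z = A *m reim v^T + 0.
  by rewrite addr0 -reimZ zv reim_mul.
rewrite frob_norm0 mulr0 => le0.
have v0 : cfrob_sq v^T = 0.
  rewrite cfrob_sq_reim (_ : ⟦reim v^T⟧ = 0) ?expr0n//.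
  by apply/eqP; rewrite eq_le le0 frob_norm_ge0.
by rewrite -[v]trmxK (cfrob_sq_eq0 v0) trmx0.
Qed.

Lemma unit_complex_cos_sin (z : C) : normc z = 1 ->
  exists2 t : R, t \in `[0, 2 * pi]%R & z = (cos t +i* sin t)%C.
Proof.
case: z => a b /= /(congr1 (fun t => t ^+ 2)).
rewrite expr1n sqr_sqrtr ?addr_ge0 ?sqr_ge0// => ab.
have a1 : -1 <= a <= 1 by apply/andP; split; nra.
have pi0 := @pi_ge0 R; have [t0 tpi] := (acos_ge0 a1, acos_lepi a1).
have sinE : sin (acos a) = `|b|.
  by rewrite sin_acos// (_ : 1 - a ^+ 2 = b ^+ 2) ?sqrtr_sqr//; lra.
have [b0|b0] := leP 0 b.
  exists (acos a); first by rewrite in_itv/= t0/=; lra.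
  by rewrite acosK// sinE ger0_norm.
exists (2 * pi - acos a); first by rewrite in_itv/=; lra.
by rewrite mulr_natl addrC cosD2pi sinD2pi cosN sinN acosK// sinE ltr0_norm// opprK.
Qed.

End ComplexGain.

(** * The cost as a gain bound *)

Section HinfGain.
Context {R : realType} {nx nu nw : nat}.
Variables (A : 'M[R]_nx) (B : 'M[R]_(nx, nu)) (Bw : 'M[R]_(nx, nw)).
Variables (Q : 'M[R]_nx) (Ru : 'M[R]_nu).
Local Notation C := R[i].
Local Notation normc := ComplexField.Normc.normc.
Local Notation J := (Hinf_cost A B Bw Q Ru).

Definition output_mx (K : 'M[R]_(nu, nx)) : 'M[R]_(nx + nu, nx) :=
  col_mx (sqrtmx Q) (sqrtmx Ru *m K).

Definition closed_loop (K : 'M[R]_(nu, nx)) : 'M[R]_nx := A + B *m K.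

Lemma resolvent_gain n p q (F : 'M[R]_n) (G : 'M[R]_(n, p)) (D : 'M[R]_(q, n)) M :
  resolvent_bound F M -> gain F G D ((⟦D⟧ * M * ⟦G⟧) ^+ 2).
Proof.
move=> [M0 resF] m U x w oU /(resF _ _ _ _ oU) xle.
rewrite -exprMn ler_sqr ?nnegrE ?mulr_ge0 ?frob_norm_ge0//.
rewrite (le_trans (frob_normM _ _))// -!mulrA ler_wpM2l ?frob_norm_ge0//.
by rewrite (le_trans xle)// ler_wpM2l// frob_normM.
Qed.

Lemma normc_cos_sin (t : R) : normc (cos t +i* sin t)%C = 1.
Proof. by rewrite /= cos2Dsin2 sqrtr1. Qed.

Lemma transfer_solve K M t (w : 'cV[C]_nw) : resolvent_bound (closed_loop K) M ->
  exists2 x : 'cV[C]_nx,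
    (cos t +i* sin t)%C *: x = complexify (closed_loop K) *m x + complexify Bw *m w &
    transfer_zw A B Bw Q Ru K t *m w = complexify (output_mx K) *m x.
Proof.
move=> resK; have zF := resolvent_unitmx resK (normc_cos_sin t).
exists (invmx ((cos t +i* sin t)%C%:M - complexify (closed_loop K)) *m (complexify Bw *m w)).
  set x := _ *m (_ *m w).
  apply/eqP; rewrite [X in _ == X]addrC -subr_eq -mul_scalar_mx -mulmxBl /x mulKVmx//.
by rewrite /transfer_zw /output_mx !mulmxA.
Qed.

Lemma sigma_max_transfer_le K M g t : resolvent_bound (closed_loop K) M -> 0 <= g ->
  gain (closed_loop K) Bw (output_mx K) (g ^+ 2) ->
  sigma_max (transfer_zw A B Bw Q Ru K t) <= g.
Proof.
move=> resK g0 /complex_gain_of_gain gK; apply: sigma_max_le => // w.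
by have [x xE ->] := transfer_solve t w resK; apply: gK xE; exact: normc_cos_sin.
Qed.

Lemma Hinf_cost_le K M g : resolvent_bound (closed_loop K) M -> 0 <= g ->
  gain (closed_loop K) Bw (output_mx K) (g ^+ 2) -> J K <= g.
Proof.
move=> resK g0 gK; apply: sup_le_nonneg => // _ [t _ <-].
exact: sigma_max_transfer_le resK g0 gK.
Qed.

Lemma Hinf_cost_ge0 K : 0 <= J K.
Proof. by apply: sup_nonneg => _ [t _ <-]; exact: sigma_max_ge0. Qed.

(** The supremum in [J] is an upper bound because the resolvent is bounded on the
    whole unit circle. *)
Lemma Hinf_cost_gain K M : resolvent_bound (closed_loop K) M ->
  gain (closed_loop K) Bw (output_mx K) (J K ^+ 2).
Proof.
move=> resK; apply: gain_of_complex_gain => z x w z1 zx.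
have [t t02 zE] := unit_complex_cos_sin z1.
have [y yE Tw] := transfer_solve t w resK.
have xy : x = y.
  have zF := resolvent_unitmx resK z1; rewrite -(mulKmx zF x) -(mulKmx zF y).
  by congr (_ *m _); rewrite !mulmxBl !mul_scalar_mx zx {1}zE yE
    ![_ + complexify Bw *m w]addrC !addrK.
rewrite xy -Tw (le_trans (sigma_max_bound _ _))// ler_wpM2r ?cfrob_sq_ge0//.
rewrite ler_sqr ?nnegrE ?sigma_max_ge0 ?Hinf_cost_ge0//; apply: ub_le_sup; last by exists t.
exists (⟦output_mx K⟧ * M * ⟦Bw⟧) => _ [s _ <-].
have M0 : 0 <= M by case: resK.
apply: (sigma_max_transfer_le s resK); first by rewrite !mulr_ge0 ?frob_norm_ge0.
exact: resolvent_gain.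
Qed.

End HinfGain.

(** * Quadratic forms from the parallelogram law *)

Section QuadraticForm.
Context {R : realType}.

(** The defect [g a - a * g 1] is additive and vanishes on the integers, so it takes
    on [a *+ k] the value it takes on a fractional part, which is bounded; hence [k]
    times the defect stays bounded. *)
Lemma additive_bounded_linear (g : R -> R) (c : R) :
  (forall a b, g (a + b) = g a + g b) ->
  (forall a, 0 <= a <= 1 -> `|g a| <= c) -> forall a, g a = a * g 1.
Proof.
move=> gD gc a.
have g0 : g 0 = 0 by have := gD 0 0; rewrite addr0; lra.
have gN x : g (- x) = - g x by have := gD x (- x); rewrite subrr g0; lra.
have gMn x k : g (x *+ k) = g x *+ k.
  by elim: k => [|k IH]; rewrite ?mulr0n// !mulrS gD IH.
have gz (z : int) : g z%:~R = z%:~R * g 1.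
  by case: z => k; rewrite ?NegzE ?mulrNz ?gN ?mulNr -!pmulrn gMn mulr_natl.
apply/eqP; rewrite -subr_eq0 -normr_eq0 eq_le normr_ge0 andbT.
have scaled_le k : `|g a - a * g 1| * k%:R <= c + `|g 1|.
  have -> : `|g a - a * g 1| * k%:R = `|g (a *+ k) - a *+ k * g 1|.
    rewrite gMn -(mulr_natr (g a)) -(mulr_natr a).
    have -> : g a * k%:R - a * k%:R * g 1 = (g a - a * g 1) * k%:R by ring.
    by rewrite normrM normr_nat.
  set y := a *+ k; have /andP[fl fu] := floor_itv y.
  set f := y - (Num.floor y)%:~R.
  have f01 : 0 <= f <= 1 by move: fu; rewrite intrD /f; lra.
  have -> : g y - y * g 1 = g f - f * g 1.
    by rewrite /f gD gN gz; ring.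
  rewrite (le_trans (ler_normB _ _))// lerD ?gc// normrM ler_piMl//.
  by rewrite ger0_norm; case/andP: f01.
have c0 : 0 <= c + `|g 1|.
  by rewrite (le_trans _ (scaled_le 0%N))// mulr0.
apply/ler_addgt0Pl => e e0; rewrite addr0.
have := scaled_le (Num.truncn ((c + `|g 1|) / e)).+1.
have := truncnS_gt ((c + `|g 1|) / e).
rewrite ltr_pdivrMr// => lt1 le2; rewrite leNgt; apply/negP => gt3.
have : e * (Num.truncn ((c + `|g 1|) / e)).+1%:R <=
  `|g a - a * g 1| * (Num.truncn ((c + `|g 1|) / e)).+1%:R.
  by rewrite ler_wpM2r// ltW.
by move: lt1 le2; rewrite mulrC; lra.
Qed.

(** Jordan-von Neumann: polarization is biadditive by the parallelogram law alone,
    and boundedness upgrades biadditive to bilinear. *)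
Lemma parallelogram_quadratic n (V : 'cV[R]_n -> R) (c : R) :
  (forall x y, V (x + y) + V (x - y) = 2 * V x + 2 * V y) ->
  (forall x, `|V x| <= c * ⟦x⟧ ^+ 2) ->
  exists P : 'M[R]_n, P^T = P /\ forall x, V x = ⟪x, P *m x⟫.
Proof.
move=> par Vc.
have V0 : V 0 = 0 by have := par 0 0; rewrite subr0 addr0; lra.
have VN x : V (- x) = V x by have := par 0 x; rewrite add0r sub0r V0; lra.
pose b x y := (V (x + y) - V (x - y)) / 4.
have bC x y : b x y = b y x by rewrite /b (addrC x y) -(VN (x - y)) opprB.
have bV x : b x x = V x.
  by rewrite /b subrr V0; have := par x x; rewrite subrr V0; lra.
have bD x x' y : b (x + x') y = b x y + b x' y.
  have e1 := par (x + y) x'; have e2 := par (x - y) x'.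
  have e3 := par (x' + y) x; have e4 := par (x' - y) x.
  have s1 : V (x + y - x') = V (x' - y - x).
    by rewrite -VN !opprB opprD addrCA addrC.
  have s2 : V (x - y - x') = V (x' + y - x).
    by rewrite -VN !opprB addrA.
  rewrite (addrAC x y x') in e1; rewrite (addrAC x (- y) x') in e2.
  rewrite (addrAC x' y x) (addrC x' x) in e3.
  rewrite (addrAC x' (- y) x) (addrC x' x) in e4.
  by rewrite /b; lra.
have bZ a x y : b (a *: x) y = a * b x y.
  (* Boundedness of [V] on the segment from [0] to [x] makes [g] linear. *)
  pose g t := b (t *: x) y.
  have gD s t : g (s + t) = g s + g t by rewrite /g scalerDl bD.
  have -> : b x y = g 1 by rewrite /g scale1r.
  apply: (@additive_bounded_linear g (`|c| * (⟦x⟧ + ⟦y⟧) ^+ 2)) => // t /andP[t0 t1].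
  have Vle z : ⟦z⟧ <= ⟦x⟧ + ⟦y⟧ -> `|V z| <= `|c| * (⟦x⟧ + ⟦y⟧) ^+ 2.
    move=> zle; rewrite (le_trans (Vc z))// (@le_trans _ _ (`|c| * ⟦z⟧ ^+ 2))//.
      by rewrite ler_wpM2r ?sqr_ge0// ler_norm.
    by rewrite ler_wpM2l// ler_sqr ?nnegrE ?addr_ge0 ?frob_norm_ge0.
  have tx : ⟦t *: x⟧ <= ⟦x⟧ by rewrite frob_normZ ger0_norm// ler_piMl ?frob_norm_ge0.
  have h1 : `|V (t *: x + y)| <= `|c| * (⟦x⟧ + ⟦y⟧) ^+ 2.
    by apply: Vle; rewrite (le_trans (frob_normD _ _))// lerD2r.
  have h2 : `|V (t *: x - y)| <= `|c| * (⟦x⟧ + ⟦y⟧) ^+ 2.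
    by apply: Vle; rewrite (le_trans (frob_normB _ _))// lerD2r.
  have K0 := le_trans (normr_ge0 _) h1.
  rewrite /g /b normrM [`|4^-1|]ger0_norm//.
  move: (`|c| * _) h1 h2 K0 => K h1 h2 K0.
  by have := ler_normB (V (t *: x + y)) (V (t *: x - y)); lra.
have b0 y : b 0 y = 0 by rewrite -(scale0r 0) bZ mul0r.
have bE x y : b x y = \sum_i x i 0 * b (delta_mx i 0) y.
  rewrite {1}[x]matrix_sum_delta.
  rewrite (big_morph (b^~ y) (fun u v => bD u v y) (b0 y)); apply: eq_bigr => i _.
  by rewrite big_ord1 bZ.
exists (\matrix_(i, j) b (delta_mx i 0) (delta_mx j 0)); split=> [|x].
  by apply/matrixP => i j; rewrite !mxE bC.
rewrite -bV bE frob_innerE big_ord1; apply: eq_bigr => i _; congr (_ * _).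
by rewrite bC bE mxE; apply: eq_bigr => j _; rewrite mxE mulrC bC.
Qed.

End QuadraticForm.

(** * The bounded real lemma *)

Section BoundedReal.
Context {R : realType} {n p q : nat}.
Variables (A : 'M[R]_n) (B : 'M[R]_(n, p)) (D : 'M[R]_(q, n)) (l : R).
Implicit Types (x y : 'cV[R]_n) (w : 'cV[R]_p).

Let supply x w : R := ⟦D *m x⟧ ^+ 2 - l * ⟦w⟧ ^+ 2.

(** [steer x v]: some finite input sequence drives the state from [x] to rest, and the
    supply accumulated on the way is [v]. Ending at rest lets two sequences of
    different lengths be added, by padding the shorter one with zero inputs. *)
Inductive steer : 'cV[R]_n -> R -> Prop :=
| steer_rest : steer 0 0
| steer_step x w v : steer (A *m x + B *m w) v -> steer x (supply x w + v).

Lemma supplyZ k x w : supply (k *: x) (k *: w) = k ^+ 2 * supply x w.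
Proof. by rewrite /supply -scalemxAr !frob_normZ !exprMn !real_normK ?num_real//; ring. Qed.

Lemma frob_parallelogram m k (x y : 'M[R]_(m, k)) :
  ⟦x + y⟧ ^+ 2 + ⟦x - y⟧ ^+ 2 = 2 * ⟦x⟧ ^+ 2 + 2 * ⟦y⟧ ^+ 2.
Proof. by rewrite !frob_normK !frob_innerL (frob_innerC y x); ring. Qed.

Lemma supply_parallelogram x y w u :
  supply (x + y) (w + u) + supply (x - y) (w - u) = 2 * supply x w + 2 * supply y u.
Proof.
have := frob_parallelogram (D *m x) (D *m y); have := frob_parallelogram w u.
by rewrite /supply mulmxDr mulmxBr => /(congr1 ( *%R l)) wu xy; lra.
Qed.

Lemma steer_scale k x v : steer x v -> steer (k *: x) (k ^+ 2 * v).
Proof.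
elim=> [|{}x w {}v _ IH]; first by rewrite scaler0 mulr0; exact: steer_rest.
rewrite mulrDr -supplyZ; apply: steer_step.
by rewrite -!scalemxAr -scalerDr.
Qed.

Lemma steer_parallelogram x a y b : steer x a -> steer y b ->
  exists c d, [/\ steer (x + y) c, steer (x - y) d & c + d = 2 * a + 2 * b].
Proof.
move=> xa; elim: xa y b => [|{}x w {}a xa IH] y b yb.
  exists b, b; split; [by rewrite add0r| |by ring].
  by have := steer_scale (-1) yb; rewrite sqrrN expr1n mul1r scaleN1r sub0r.
case: yb => [|{}y u {}b yb].
  by exists (supply x w + a), (supply x w + a); split;
    [rewrite addr0; exact: steer_step|rewrite subr0; exact: steer_step|ring].
have [c [d [xc xd cd]]] := IH _ _ yb.
exists (supply (x + y) (w + u) + c), (supply (x - y) (w - u) + d); split.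
- by apply: steer_step; rewrite !mulmxDr addrACA.
- by apply: steer_step; rewrite !mulmxBr addrACA -opprD.
- by have := supply_parallelogram x y w u; lra.
Qed.

Lemma steer_trajectory x v : steer x v ->
  exists N (X : nat -> 'cV[R]_n) (W : nat -> 'cV[R]_p),
  [/\ X 0%N = x, X N = 0, forall t, (t < N)%N -> X t.+1 = A *m X t + B *m W t &
      v = \sum_(t < N) supply (X t) (W t)].
Proof.
elim=> [|{}x w {}v _ [N [X [W [X0 XN XW vE]]]]].
  by exists 0%N, (fun=> 0), (fun=> 0); rewrite big_ord0.
exists N.+1, (fun t => if t is s.+1 then X s else x), (fun t => if t is s.+1 then W s else w).
split=> // [[|t]//|]; first by rewrite ltnS => /XW.
by rewrite big_ord_recl vE.
Qed.

Hypothesis gainABD : gain A B D l.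

(** A trajectory from rest to rest closes up into a periodic one: putting its states
    side by side turns the recursion into [x U = A x + B w] with [U] the cyclic
    shift. *)
Lemma loop_supply_le0 N (X : nat -> 'cV[R]_n) (W : nat -> 'cV[R]_p) :
  X 0%N = 0 -> X N.+1 = 0 ->
  (forall t, (t < N.+1)%N -> X t.+1 = A *m X t + B *m W t) ->
  \sum_(t < N.+1) supply (X t) (W t) <= 0.
Proof.
move=> X0 XN XW; pose s := perm (can_inj (@ordSK N.+1)).
pose U : 'M[R]_N.+1 := perm_mx s^-1%g.
have oU : orthogonalmx U by rewrite /orthogonalmx tr_perm_mx -perm_mxM invgK mulgV perm_mx1.
pose Xm := \matrix_(i < n, t < N.+1) X t i 0; pose Wm := \matrix_(i < p, t < N.+1) W t i 0.
have colX (t : 'I_N.+1) : col t Xm = X t by apply/colP => i; rewrite !mxE.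
have colW (t : 'I_N.+1) : col t Wm = W t by apply/colP => i; rewrite !mxE.
have XmU : Xm *m U = A *m Xm + B *m Wm.
  rewrite -col_permE; apply/matrixP => i t.
  suff /colP/(_ i) : col t (col_perm s Xm) = col t (A *m Xm + B *m Wm) by rewrite !mxE.
  rewrite raddfD/= !col_mulmx colX colW -XW//.
  apply/colP => {}i; rewrite !mxE permE /=.
  have := ltn_ord t; rewrite ltnS leq_eqVlt => /orP[/eqP tN|tN].
    by rewrite tN modnn X0 XN !mxE.
  by rewrite modn_small// ltnS.
have := gainABD oU XmU; rewrite !frob_norm_col mulr_sumr -subr_ge0 -sumrB => le0.
rewrite -oppr_ge0 -sumrN (le_trans le0)//.
rewrite le_eqVlt; apply/orP; left; apply/eqP; apply: eq_bigr => t _.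
by rewrite col_mulmx colX colW opprB.
Qed.

Variable Bi : 'M[R]_(p, n).
Hypothesis BBi : B *m Bi = 1%:M.

(** A right inverse of [B] reaches [x] from rest in one step, which completes the
    trajectory into a loop. *)
Lemma steer_le x v : steer x v -> v <= l * ⟦Bi *m x⟧ ^+ 2.
Proof.
move=> /steer_trajectory[N [X [W [X0 XN XW ->]]]].
pose X' t := if t is s.+1 then X s else 0.
pose W' t := if t is s.+1 then W s else Bi *m x.
have := @loop_supply_le0 N X' W' erefl XN.
rewrite big_ord_recl /= {1}/supply mulmx0 frob_norm0 expr0n/= sub0r => le0.
rewrite -subr_le0 addrC; apply: le0 => -[_|t /XW//].
by rewrite /= X0 mulmx0 add0r (mulmxA B) BBi mul1mx.
Qed.

Lemma steer_one_step x : steer x (supply x (- (Bi *m (A *m x)))).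
Proof.
rewrite -[supply _ _]addr0; apply: steer_step.
by rewrite mulmxN (mulmxA B) BBi mul1mx subrr; exact: steer_rest.
Qed.

(** The available storage. *)
Let V x := sup [set v | steer x v].

Let steer_has_sup x : has_sup [set v | steer x v].
Proof.
split; first by exists (supply x (- (Bi *m (A *m x)))); exact: steer_one_step.
by exists (l * ⟦Bi *m x⟧ ^+ 2) => v /steer_le.
Qed.

Let steer_le_V x v : steer x v -> v <= V x.
Proof. by move=> xv; apply: ub_le_sup => //; case: (steer_has_sup x). Qed.

Let V_le x c : (forall v, steer x v -> v <= c) -> V x <= c.
Proof. by move=> xc; apply: ge_sup => //; case: (steer_has_sup x). Qed.

(** The other inequality of the parallelogram law is this one applied to [x + y] and
    [x - y], since [V] is homogeneous of degree two. *)
Let V_superparallelogram x y : 2 * V x + 2 * V y <= V (x + y) + V (x - y).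
Proof.
have le1 b : steer y b -> forall a, steer x a -> a <= (V (x + y) + V (x - y)) / 2 - b.
  move=> yb a xa; have [c [d [xc xd cd]]] := steer_parallelogram xa yb.
  by have := steer_le_V xc; have := steer_le_V xd; lra.
have : V y <= (V (x + y) + V (x - y)) / 2 - V x.
  by apply: V_le => b yb; have := V_le (le1 b yb); lra.
lra.
Qed.

Let V_double x : V (2 *: x) = 4 * V x.
Proof.
apply/eqP; rewrite eq_le; apply/andP; split.
  apply: V_le => v /(steer_scale (2^-1)); rewrite scalerA mulVf ?pnatr_eq0// scale1r.
  by move=> /steer_le_V; lra.
have : V x <= V (2 *: x) / 4.
  by apply: V_le => v /(steer_scale 2)/steer_le_V; lra.
lra.
Qed.

Let V_parallelogram x y : V (x + y) + V (x - y) = 2 * V x + 2 * V y.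
Proof.
apply/eqP; rewrite eq_le V_superparallelogram andbT.
have := V_superparallelogram (x + y) (x - y).
have -> : x + y + (x - y) = 2 *: x by rewrite addrACA subrr addr0 scaler_nat mulr2n.
have -> : x + y - (x - y) = 2 *: y by rewrite opprB addrC addrA subrK scaler_nat mulr2n.
by rewrite !V_double; lra.
Qed.

(** The available storage satisfies the dissipation inequality by its definition as a
    supremum; it is finite because a right inverse [Bi] of [B] makes every state
    reachable and controllable to rest in one step, and it is quadratic because a
    supremum of jointly quadratic costs obeys the parallelogram law. *)
Lemma bounded_real : 0 <= l -> exists P : 'M[R]_n, P^T = P /\
  forall m (x : 'M[R]_(n, m)) (w : 'M[R]_(p, m)),
    ⟪A *m x + B *m w, P *m (A *m x + B *m w)⟫ + ⟦D *m x⟧ ^+ 2 - l * ⟦w⟧ ^+ 2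
      <= ⟪x, P *m x⟫.
Proof.
move=> l0.
have [|P [PT VE]] := @parallelogram_quadratic _ _ V
    (l * ⟦Bi⟧ ^+ 2 + l * ⟦Bi *m A⟧ ^+ 2) V_parallelogram.
  have sq_le k m (M : 'M[R]_(k, n)) (x : 'M[R]_(n, m)) : ⟦M *m x⟧ ^+ 2 <= ⟦M⟧ ^+ 2 * ⟦x⟧ ^+ 2.
    by rewrite -exprMn ler_sqr ?nnegrE ?mulr_ge0 ?frob_norm_ge0// frob_normM.
  move=> x; have up := V_le (@steer_le x); have lo := steer_le_V (steer_one_step x).
  have := ler_wpM2l l0 (sq_le _ _ Bi x); have := ler_wpM2l l0 (sq_le _ _ (Bi *m A) x).
  move: lo; rewrite /supply frob_normN mulmxA => lo.
  have := sqr_ge0 (⟦D *m x⟧); have := mulr_ge0 l0 (mulr_ge0 (sqr_ge0 ⟦Bi⟧) (sqr_ge0 ⟦x⟧)).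
  have := mulr_ge0 l0 (mulr_ge0 (sqr_ge0 ⟦Bi *m A⟧) (sqr_ge0 ⟦x⟧)).
  by rewrite ler_norml => *; apply/andP; split; lra.
exists P; split=> // m x w.
rewrite !frob_inner_cols !frob_norm_col mulr_sumr -sumrN -!big_split/=.
apply: ler_sum => j _; rewrite !col_mulmx raddfD/= !col_mulmx -!VE.
set xj := col j x; set wj := col j w.
rewrite -addrA addrC -lerBrDl; apply: V_le => v /(@steer_step xj wj)/steer_le_V.
by rewrite /supply; lra.
Qed.

End BoundedReal.

Section StoragePositivity.
Context {R : realType}.

(** Along [A ^+ k x] the form decreases and tends to zero. *)
Lemma stein_ge0 n (A P : 'M[R]_n) :
  power_stable A ->
  (forall x : 'cV[R]_n, ⟪A *m x, P *m (A *m x)⟫ <= ⟪x, P *m x⟫) ->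
  forall m (x : 'M[R]_(n, m)), 0 <= ⟪x, P *m x⟫.
Proof.
move=> [c [r [c0 r0 r1 decay]]] stein m x.
rewrite frob_inner_cols; apply: sumr_ge0 => j _; rewrite col_mulmx.
move: (col j x) => {j}y.
have le_pow k : ⟪A ^+ k *m y, P *m (A ^+ k *m y)⟫ <= ⟪y, P *m y⟫.
  elim: k => [|k IH]; first by rewrite expr0 mul1mx.
  by rewrite exprS -mulmxE -mulmxA (le_trans (stein _)).
rewrite -oppr_le0; apply: (@le_geometric_tail R (r ^+ 2) (⟦P⟧ * (c * ⟦y⟧) ^+ 2)).
- exact: sqr_ge0.
- by rewrite expr_lt1.
move=> k; rewrite addr0; have := le_pow k; set z := A ^+ k *m y => zy.
have zle : ⟦z⟧ <= c * r ^+ k * ⟦y⟧.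
  by rewrite (le_trans (frob_normM _ _))// ler_wpM2r ?frob_norm_ge0.
have z2 : ⟦z⟧ ^+ 2 <= (c * r ^+ k * ⟦y⟧) ^+ 2.
  by rewrite ler_sqr ?nnegrE ?frob_norm_ge0 ?mulr_ge0 ?exprn_ge0 ?frob_norm_ge0.
have zP : `|⟪z, P *m z⟫| <= ⟦P⟧ * ⟦z⟧ ^+ 2.
  rewrite (le_trans (frob_inner_abs _ _))// expr2 mulrA [leRHS]mulrC.
  by rewrite ler_wpM2l ?frob_norm_ge0// frob_normM.
have := ler_wpM2l (frob_norm_ge0 P) z2.
have := ler_norm (- ⟪z, P *m z⟫); rewrite normrN.
rewrite -exprM mulnC exprM !exprMn -/(r ^+ k); lra.
Qed.

End StoragePositivity.

(** * Storage functions and adjoint trajectories *)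

Section DualStorage.
Context {R : realType}.

(** The bounded real lemma for the transposed system, whose input matrix is [C^T].
    Appending a small multiple of the state to the output makes that input matrix
    right invertible, at the price of raising the level from [l0] to some [l < l1]. *)
Lemma dual_storage n p q (F : 'M[R]_n) (G : 'M[R]_(n, p)) (C : 'M[R]_(q, n)) M (l0 l1 : R) :
  resolvent_bound F M -> power_stable F -> 0 <= l0 -> l0 < l1 -> gain F G C l0 ->
  exists X l, [/\ X^T = X, forall m (y : 'M[R]_(n, m)), 0 <= ⟪y, X *m y⟫,
    0 <= l, l < l1 &
    forall m (y : 'M[R]_(n, m)) (v : 'M[R]_(q, m)),
      ⟪F^T *m y + C^T *m v, X *m (F^T *m y + C^T *m v)⟫ + ⟦G^T *m y⟧ ^+ 2
        - l * ⟦v⟧ ^+ 2 <= ⟪y, X *m y⟫].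
Proof.
move=> resF stF l00 l01 gainF; have [M0 resFE] := resF.
pose d := (M * ⟦G⟧) ^+ 2; have d0 : 0 <= d := sqr_ge0 _.
(* [d] bounds the squared gain from [w] to the state, so adding [e *: x] to the
   output raises the level by [e2 * d], at most half of the available room. *)
pose e2 := (l1 - l0) / (2 * (d + 1)).
have e2_gt0 : 0 < e2 by rewrite divr_gt0 ?subr_gt0// mulr_gt0// ltr_wpDl.
pose e := Num.sqrt e2; have e_gt0 : 0 < e by rewrite sqrtr_gt0.
have eE : e ^+ 2 = e2 by rewrite sqr_sqrtr// ltW.
pose l := l0 + e2 * d; have lge0 : 0 <= l by rewrite addr_ge0// mulr_ge0// ltW.
have l_lt : l < l1.
  have : e2 * (2 * (d + 1)) = l1 - l0 by rewrite divfK// gt_eqF// mulr_gt0// ltr_wpDl.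
  by rewrite /l; nra.
pose Ce := col_mx C e%:M.
have gainCe : gain F G Ce l.
  move=> m U x w oU xU; rewrite frob_normK mul_col_mx frob_inner_col_mx -!frob_normK.
  rewrite mul_scalar_mx frob_normZ exprMn ger0_norm ?(ltW e_gt0)// eE mulrDl.
  rewrite lerD ?(gainF _ _ _ _ oU xU)// -mulrA ler_wpM2l ?(ltW e2_gt0)//.
  rewrite -exprMn ler_sqr ?nnegrE ?mulr_ge0 ?frob_norm_ge0// -mulrA.
  by rewrite (le_trans (resFE _ _ _ _ oU xU))// ler_wpM2l// frob_normM.
have := gain_tr resF lge0 gainCe.
have right_inv : Ce^T *m col_mx 0 (e^-1)%:M = 1%:M.
  rewrite /Ce tr_col_mx mul_row_col mulmx0 add0r tr_scalar_mx -scalar_mxM.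
  by rewrite divff// gt_eqF.
move=> gainT; have [X [XT LMI]] := bounded_real gainT right_inv lge0.
exists X, l; split=> // [|m y v].
  apply: (@stein_ge0 R n F^T X (power_stable_tr stF)) => x.
  have := LMI _ x 0; rewrite mulmx0 addr0 frob_norm0 expr0n mulr0 subr0.
  by have := sqr_ge0 ⟦G^T *m x⟧; lra.
have := LMI _ y (col_mx v 0).
rewrite {1 2}/Ce tr_col_mx mul_row_col mulmx0 addr0.
by rewrite (frob_normK (col_mx _ _)) frob_inner_col_mx -!frob_normK frob_norm0 expr0n addr0.
Qed.

End DualStorage.

Section NearOptimalTrajectories.
Context {R : realType} {n p q : nat}.
Variables (F : 'M[R]_n) (G : 'M[R]_(n, p)) (C : 'M[R]_(q, n)) (P : 'M[R]_n) (g2 M : R).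
Hypotheses (g2_ge0 : 0 <= g2) (resF : resolvent_bound F M) (PT : P^T = P).
Hypothesis LMI : forall m (x : 'M[R]_(n, m)) (w : 'M[R]_(p, m)),
  ⟪F *m x + G *m w, P *m (F *m x + G *m w)⟫ + ⟦C *m x⟧ ^+ 2 - g2 * ⟦w⟧ ^+ 2
    <= ⟪x, P *m x⟫.

Lemma sym_swap m (x y : 'M[R]_(n, m)) : ⟪x, P *m y⟫ = ⟪y, P *m x⟫.
Proof. by rewrite frob_innerC frob_inner_mull PT. Qed.

Lemma quad_le k m (S : 'M[R]_k) (x : 'M[R]_(k, m)) : `|⟪x, S *m x⟫| <= ⟦S⟧ * ⟦x⟧ ^+ 2.
Proof.
rewrite (le_trans (frob_inner_abs _ _))// expr2 mulrA [leRHS]mulrC.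
by rewrite ler_wpM2l ?frob_norm_ge0// frob_normM.
Qed.

(** The dissipation form is nonnegative, and it equals the gap
    [g2 * |w|^2 - |C x|^2] at a steady state, so its gradient there is at most of the
    order of the square root of the gap. *)
Lemma storage_gradient : exists2 k, 0 <= k &
  forall m (U : 'M[R]_m) x w, orthogonalmx U -> x *m U = F *m x + G *m w ->
  ⟦P *m x - F^T *m (P *m x *m U) - C^T *m (C *m x)⟧ ^+ 2 +
  ⟦g2 *: w - G^T *m (P *m x *m U)⟧ ^+ 2
    <= k * (g2 * ⟦w⟧ ^+ 2 - ⟦C *m x⟧ ^+ 2).
Proof.
pose k := ⟦P⟧ + ⟦P⟧ * (2 * (⟦F⟧ ^+ 2 + ⟦G⟧ ^+ 2)) + g2 + 1.
have k1 : 1 <= k.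
  by rewrite lerDr !addr_ge0// ?mulr_ge0 ?addr_ge0 ?frob_norm_ge0 ?sqr_ge0.
have k_gt0 : 0 < k by rewrite (lt_le_trans ltr01).
exists k => [|m U x w oU xU]; first exact: ltW.
set y := P *m x - _ - _; set v := g2 *: w - _; set E := _ + _.
set h := F *m y + G *m v.
have gradE : ⟪h, P *m x *m U⟫ + ⟪C *m y, C *m x⟫ - g2 * ⟪v, w⟫ - ⟪y, P *m x⟫ = - E.
  rewrite /E !frob_normK {4}/y {3}/v !(frob_innerDr, frob_innerNr, frob_innerZr).
  by rewrite /h frob_innerDl !frob_inner_mull; ring.
have h2 : ⟦h⟧ ^+ 2 <= 2 * (⟦F⟧ ^+ 2 + ⟦G⟧ ^+ 2) * E.
  have : ⟦h⟧ ^+ 2 <= (⟦F⟧ * ⟦y⟧ + ⟦G⟧ * ⟦v⟧) ^+ 2.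
    rewrite ler_sqr ?nnegrE ?addr_ge0 ?mulr_ge0 ?frob_norm_ge0//.
    by rewrite (le_trans (frob_normD _ _))// lerD// frob_normM.
  rewrite /E; have := sqr_ge0 (⟦F⟧ * ⟦y⟧ - ⟦G⟧ * ⟦v⟧).
  have := sqr_ge0 (⟦F⟧ * ⟦v⟧); have := sqr_ge0 (⟦G⟧ * ⟦y⟧).
  by rewrite !exprMn; nra.
have y2 : ⟦y⟧ ^+ 2 <= E by rewrite lerDl sqr_ge0.
have v2 : ⟦v⟧ ^+ 2 <= E by rewrite lerDr sqr_ge0.
have curv : - (k * E) <=
    ⟪h, P *m h⟫ + ⟦C *m y⟧ ^+ 2 - g2 * ⟦v⟧ ^+ 2 - ⟪y, P *m y⟫.
  have := quad_le P h; have := quad_le P y; rewrite !ler_norml => /andP[_ Py] /andP[Ph _].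
  have := ler_wpM2l (frob_norm_ge0 P) h2; have := ler_wpM2l (frob_norm_ge0 P) y2.
  have := ler_wpM2l g2_ge0 v2; have := sqr_ge0 ⟦C *m y⟧.
  have : 0 <= E by rewrite addr_ge0 ?sqr_ge0.
  by rewrite /k; lra.
have hE : h = F *m y + G *m v by [].
(* The form is tested at a gradient step of length [k^-1], where [k] bounds its
   curvature. *)
clearbody E h v y; have := LMI (x - k^-1 *: y) (w - k^-1 *: v).
have -> : F *m (x - k^-1 *: y) + G *m (w - k^-1 *: v) = x *m U - k^-1 *: h.
  by rewrite hE xU !mulmxBr -!scalemxAr scalerDr opprD addrACA.
rewrite !mulmxBr -!scalemxAr !frob_normK !frob_innerL -!frob_normK.
rewrite !(sym_swap _ h) !(sym_swap _ y) (frob_innerC (C *m x) (C *m y)) (frob_innerC w v).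
have -> : ⟪x *m U, P *m (x *m U)⟫ = ⟪x, P *m x⟫ by rewrite mulmxA frob_inner_ortho.
move: gradE curv; rewrite -(mulmxA P x U).
set a1 := ⟪h, P *m (x *m U)⟫; set a2 := ⟪C *m y, C *m x⟫; set a3 := ⟪v, w⟫.
set a4 := ⟪y, P *m x⟫; set b1 := ⟪h, P *m h⟫; set b4 := ⟪y, P *m y⟫.
set b2 := ⟦C *m y⟧ ^+ 2; set b3 := ⟦v⟧ ^+ 2.
set c0 := ⟪x, P *m x⟫; set c1 := ⟦C *m x⟧ ^+ 2; set c2 := ⟦w⟧ ^+ 2.
move=> gradE curv ineq.
have inv0 : 0 < k^-1 by rewrite invr_gt0.
have inv_curv : - (k^-1 * E) <= k^-1 ^+ 2 * (b1 + b2 - g2 * b3 - b4).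
  have -> : - (k^-1 * E) = k^-1 ^+ 2 * - (k * E) by field; rewrite gt_eqF.
  by rewrite ler_wpM2l// sqr_ge0.
have : k^-1 * (a1 + a2 - g2 * a3 - a4) = k^-1 * - E by rewrite gradE.
move=> gradE'; have : k^-1 * E <= g2 * c2 - c1 by lra.
by rewrite -(ler_pM2l k_gt0) mulrA divff ?gt_eqF// mul1r.
Qed.

(** The adjoint state [z] and [P x] solve the same linear equation up to the gradient
    of the dissipation form, so their difference is controlled by the resolvent. *)
Lemma adjoint_storage : exists2 c, 0 <= c &
  forall m (U : 'M[R]_m) x w z, orthogonalmx U -> x *m U = F *m x + G *m w ->
  z = F^T *m (z *m U) + C^T *m (C *m x) ->
  ⟦z - P *m x⟧ ^+ 2 <= c * (g2 * ⟦w⟧ ^+ 2 - ⟦C *m x⟧ ^+ 2) /\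
  ⟦g2 *: w - G^T *m (z *m U)⟧ ^+ 2 <= c * (g2 * ⟦w⟧ ^+ 2 - ⟦C *m x⟧ ^+ 2).
Proof.
have [k k0 grad] := storage_gradient.
have [M0 resFt] := resolvent_bound_tr resF.
exists ((M + 1 + ⟦G⟧ * M) ^+ 2 * 2 * k) => [|m U x w z oU xU zE].
  by rewrite mulr_ge0// mulr_ge0// sqr_ge0.
have := grad _ _ _ _ oU xU; set y := P *m x - _ - _; set v := g2 *: w - _.
set eta := _ - _ ^+ 2 => sumE.
pose r := z - P *m x.
have rU : r = F^T *m (r *m U) - y.
  rewrite /r /y {1}zE mulmxBl mulmxBr.
  by apply/matrixP => i j; rewrite !mxE; ring.
have rE : r *m U^T = F^T *m r - y *m U^T.
  by rewrite {1}rU mulmxBl -mulmxA orthogonalmxKr.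
have rle : ⟦r⟧ <= M * ⟦y⟧.
  have := resFt _ _ _ _ (orthogonalmx_tr oU) rE.
  by rewrite frob_normN frob_norm_ortho//; exact: orthogonalmx_tr.
have sle : ⟦g2 *: w - G^T *m (z *m U)⟧ <= ⟦v⟧ + ⟦G⟧ * (M * ⟦y⟧).
  have -> : g2 *: w - G^T *m (z *m U) = v - G^T *m (r *m U).
    rewrite /v /r mulmxBl mulmxBr.
    by apply/matrixP => i j; rewrite !mxE; ring.
  rewrite (le_trans (frob_normB _ _))// lerD2l (le_trans (frob_normM _ _))//.
  by rewrite frob_norm_tr ler_wpM2l ?frob_norm_ge0// frob_norm_ortho.
pose N := M + 1 + ⟦G⟧ * M.
have key s : 0 <= s -> s <= N * (⟦y⟧ + ⟦v⟧) -> s ^+ 2 <= N ^+ 2 * 2 * k * eta.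
  move=> s0 sN; have N0 : 0 <= N by rewrite !addr_ge0// mulr_ge0// frob_norm_ge0.
  have : s ^+ 2 <= (N * (⟦y⟧ + ⟦v⟧)) ^+ 2.
    have yv0 : 0 <= ⟦y⟧ + ⟦v⟧ by rewrite addr_ge0 ?frob_norm_ge0.
    by rewrite ler_sqr ?nnegrE ?(mulr_ge0 N0 yv0).
  have sum2 : (⟦y⟧ + ⟦v⟧) ^+ 2 <= 2 * (k * eta).
    by have := sqr_ge0 (⟦y⟧ - ⟦v⟧); nra.
  have := ler_wpM2l (sqr_ge0 N) sum2; rewrite exprMn; lra.
have := frob_norm_ge0 y; have := frob_norm_ge0 v; have := frob_norm_ge0 G => G0 v0 y0.
have := mulr_ge0 M0 v0; have := mulr_ge0 (mulr_ge0 G0 M0) v0.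
have := mulr_ge0 M0 y0; have := mulr_ge0 (mulr_ge0 G0 M0) y0.
by split; apply: key; rewrite ?frob_norm_ge0// /N; lra.
Qed.

End NearOptimalTrajectories.

(** * A common direction of descent *)

Section Descent.
Context {R : realType} {n nu p q : nat}.
Variables (F : 'M[R]_n) (B : 'M[R]_(n, nu)) (G : 'M[R]_(n, p)).
Variables (C : 'M[R]_(q, n)) (E : 'M[R]_(q, nu)) (M : R).
Hypothesis resF : resolvent_bound F M.

(** The gradient of half the squared output norm with respect to a perturbation
    of the input [K x], when [z] is the adjoint state of [x]. *)
Definition input_gradient m (U : 'M[R]_m) (x z : 'M[R]_(n, m)) :=
  B^T *m (z *m U) + E^T *m (C *m x).

Let M_ge0 : 0 <= M. Proof. by case: resF. Qed.

Lemma input_gradient_bounded : exists2 H, 0 <= H &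
  forall m (U : 'M[R]_m) x w z, orthogonalmx U -> x *m U = F *m x + G *m w ->
  z = F^T *m (z *m U) + C^T *m (C *m x) -> ⟦w⟧ = 1 -> ⟦input_gradient U x z⟧ <= H.
Proof.
have [_ resFE] := resF; have [_ resFt] := resolvent_bound_tr resF.
exists (⟦B^T⟧ * (M * (⟦C^T⟧ * (⟦C⟧ * (M * ⟦G⟧)))) + ⟦E^T⟧ * (⟦C⟧ * (M * ⟦G⟧))).
  by rewrite addr_ge0 ?mulr_ge0 ?frob_norm_ge0.
move=> m U x w z oU xU zE w1.
have xle : ⟦x⟧ <= M * ⟦G⟧.
  rewrite (le_trans (resFE _ _ _ _ oU xU))// ler_wpM2l//.
  by rewrite (le_trans (frob_normM _ _))// w1 mulr1.
have zU : z *m U^T = F^T *m z + C^T *m (C *m x) *m U^T.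
  by rewrite {1}zE mulmxDl -(mulmxA F^T) orthogonalmxKr.
have zle : ⟦z⟧ <= M * (⟦C^T⟧ * (⟦C⟧ * (M * ⟦G⟧))).
  rewrite (le_trans (resFt _ _ _ _ (orthogonalmx_tr oU) zU))// ler_wpM2l//.
  by rewrite frob_norm_ortho; [do 2 apply: frob_normM_le|exact: orthogonalmx_tr].
rewrite (le_trans (frob_normD _ _))// lerD//; last by do 2 apply: frob_normM_le.
by apply: frob_normM_le; rewrite frob_norm_ortho.
Qed.

Section Rate.
Variables (P X : 'M[R]_n) (Ds : 'M[R]_(nu, n)) (g2 l : R).
Hypotheses (PT : P^T = P) (XT : X^T = X).
Hypothesis X_ge0 : forall m (y : 'M[R]_(n, m)), 0 <= ⟪y, X *m y⟫.
Hypotheses (l_ge0 : 0 <= l) (l_lt : l < g2).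
Hypothesis primal : forall m (x : 'M[R]_(n, m)) (w : 'M[R]_(p, m)),
  ⟪F *m x + G *m w, P *m (F *m x + G *m w)⟫ + ⟦C *m x⟧ ^+ 2 - g2 * ⟦w⟧ ^+ 2
    <= ⟪x, P *m x⟫.
Hypothesis dual : forall m (y : 'M[R]_(n, m)) (v : 'M[R]_(q, m)),
  ⟪(F + B *m Ds)^T *m y + (C + E *m Ds)^T *m v,
    X *m ((F + B *m Ds)^T *m y + (C + E *m Ds)^T *m v)⟫
    + ⟦G^T *m y⟧ ^+ 2 - l * ⟦v⟧ ^+ 2 <= ⟪y, X *m y⟫.

Lemma primal_supply_ge0 m (U : 'M[R]_m) x w : orthogonalmx U ->
  x *m U = F *m x + G *m w -> ⟦C *m x⟧ ^+ 2 <= g2 * ⟦w⟧ ^+ 2.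
Proof.
move=> oU xU; have := primal x w.
by rewrite -xU mulmxA frob_inner_ortho//; lra.
Qed.

(** Replacing [K] by [K + Ds] changes the adjoint step from [z] to
    [y = z + Ds^T h], so [2 <h, Ds X z>] is the cross term of [|y|_X^2], and
    [|y - z|_X^2 >= 0] is dropped. *)
Lemma input_gradient_dual m (U : 'M[R]_m) x w z : orthogonalmx U ->
  x *m U = F *m x + G *m w -> z = F^T *m (z *m U) + C^T *m (C *m x) ->
  2 * ⟪input_gradient U x z, Ds *m X *m z⟫ <=
    l * ⟦C *m x⟧ ^+ 2 - ⟦G^T *m (z *m U)⟧ ^+ 2.
Proof.
move=> oU xU zE; set h := input_gradient U x z.
pose y := (F + B *m Ds)^T *m (z *m U) + (C + E *m Ds)^T *m (C *m x).
have yE : y - z = Ds^T *m h.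
  rewrite {1}zE /y /h /input_gradient !raddfD/= !trmx_mul !mulmxDl ?mulmxDr !mulmxA.
  by apply/matrixP => i j; rewrite ![in LHS]mxE ![in RHS]mxE; ring.
have -> : ⟪h, Ds *m X *m z⟫ = ⟪y - z, X *m z⟫.
  by rewrite yE frob_inner_mull trmxK mulmxA.
have := dual (z *m U) (C *m x); rewrite -/y (mulmxA X z) frob_inner_ortho//.
clearbody y; have := X_ge0 (y - z); rewrite mulmxBr !frob_innerL.
rewrite (sym_swap XT z y); lra.
Qed.

(** [P x] replaces [z] in [input_gradient_dual] up to the square root of the gap,
    which Young's inequality trades for half of the rate and a multiple of the gap. *)
Lemma descent_rate : exists2 kappa, 0 <= kappa &
  forall m (U : 'M[R]_m) x w z, orthogonalmx U -> x *m U = F *m x + G *m w ->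
  z = F^T *m (z *m U) + C^T *m (C *m x) -> ⟦w⟧ = 1 ->
  2 * ⟪input_gradient U x z, Ds *m X *m P *m x⟫ <=
    - (g2 * (g2 - l) / 2) + kappa * (g2 - ⟦C *m x⟧ ^+ 2).
Proof.
have g2_gt0 : 0 < g2 by exact: le_lt_trans l_lt.
have [H H0 hle] := input_gradient_bounded.
have [c c0 near_adj] := adjoint_storage (ltW g2_gt0) resF PT primal.
pose a := g2 * (g2 - l); have a_gt0 : 0 < a by rewrite mulr_gt0// subr_gt0.
pose H1 := H * ⟦Ds *m X⟧; have H10 : 0 <= H1 by rewrite mulr_ge0// frob_norm_ge0.
exists ((4 * g2 ^+ 2 + 4 * H1 ^+ 2) / a * c).
  by rewrite mulr_ge0// divr_ge0 ?(ltW a_gt0)// addr_ge0// mulr_ge0// sqr_ge0.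
move=> m U x w z oU xU zE w1; set h := input_gradient U x z.
have := near_adj _ _ _ _ _ oU xU zE; rewrite w1 expr1n mulr1.
set eta := g2 - _ ^+ 2; set r := z - P *m x; set e := g2 *: w - _ => -[r2 e2].
have Cx : ⟦C *m x⟧ ^+ 2 <= g2.
  by have := primal_supply_ge0 oU xU; rewrite w1 expr1n mulr1.
have -> : ⟪h, Ds *m X *m P *m x⟫ = ⟪h, Ds *m X *m z⟫ - ⟪h, Ds *m X *m r⟫.
  by rewrite /r mulmxBr mulmxA frob_innerDr frob_innerNr subKr.
have hr : - ⟪h, Ds *m X *m r⟫ <= H1 * ⟦r⟧.
  have := frob_inner_abs h (Ds *m X *m r); rewrite ler_norml => /andP[+ _].
  rewrite lerNl => /le_trans; apply; rewrite /H1 -mulrA.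
  by rewrite ler_pM ?frob_norm_ge0// ?frob_normM// (hle _ _ _ _ _ oU xU zE w1).
have Gz : g2 ^+ 2 - 2 * g2 * ⟦e⟧ <= ⟦G^T *m (z *m U)⟧ ^+ 2.
  have -> : G^T *m (z *m U) = g2 *: w - e by rewrite /e subKr.
  clearbody e; rewrite (frob_normK (_ - _)) !frob_innerL (frob_innerC e w) -!frob_normK w1.
  have := ler_wpM2l (ltW g2_gt0) (frob_inner_le w e); rewrite w1.
  by have := sqr_ge0 ⟦e⟧; lra.
have dualh := input_gradient_dual oU xU zE.
have lCx := ler_wpM2l l_ge0 Cx.
(* Young's inequality; applied to both error terms and doubled, the constant parts
   add up to [a / 2], half of the rate. *)
have amgm k s : k * s <= a / 8 + 2 * k ^+ 2 / a * s ^+ 2.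
  have : 0 <= (a - 4 * (k * s)) ^+ 2 / (8 * a).
    by rewrite divr_ge0 ?sqr_ge0// mulr_ge0// ltW.
  rewrite (_ : _ / _ = a / 8 + 2 * k ^+ 2 / a * s ^+ 2 - k * s) ?subr_ge0//.
  by field; rewrite gt_eqF.
have m1 := amgm g2 ⟦e⟧; have m2 := amgm H1 ⟦r⟧.
have n1 : 2 * g2 ^+ 2 / a * ⟦e⟧ ^+ 2 <= 2 * g2 ^+ 2 / a * (c * eta).
  by apply: (ler_wpM2l _ e2); rewrite divr_ge0 ?(ltW a_gt0)// mulr_ge0// sqr_ge0.
have n2 : 2 * H1 ^+ 2 / a * ⟦r⟧ ^+ 2 <= 2 * H1 ^+ 2 / a * (c * eta).
  by apply: (ler_wpM2l _ r2); rewrite divr_ge0 ?(ltW a_gt0)// mulr_ge0// sqr_ge0.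
have -> : (4 * g2 ^+ 2 + 4 * H1 ^+ 2) / a * c * eta =
  2 * (2 * g2 ^+ 2 / a * (c * eta)) + 2 * (2 * H1 ^+ 2 / a * (c * eta)) by ring.
have aE : a = g2 ^+ 2 - g2 * l by rewrite /a; ring.
rewrite -/a; move: n1 n2; set u1 := _ / a * (c * eta); set u2 := _ / a * (c * eta).
move=> n1 n2; rewrite -/h in dualh; lra.
Qed.

End Rate.

(** The first condition lets the resolvent bound [M] survive the feedback [D] with
    twice the constant; the second keeps the perturbed output matrices bounded. *)
Definition small_feedback (D : 'M[R]_(nu, n)) := M * ⟦B⟧ * ⟦D⟧ <= 1 / 2 /\ ⟦D⟧ <= 1.

Lemma small_feedback_resolvent D : small_feedback D -> resolvent_bound (F + B *m D) (2 * M).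
Proof.
move=> [MBD _]; apply: resolvent_perturb => //; apply: le_trans MBD.
by rewrite -mulrA ler_wpM2l// frob_normM.
Qed.

Lemma response_lipschitz : exists2 L, 0 <= L &
  forall D1 D2, small_feedback D1 -> small_feedback D2 ->
  forall m (U : 'M[R]_m) x1 x2 w, orthogonalmx U ->
  x1 *m U = (F + B *m D1) *m x1 + G *m w -> x2 *m U = (F + B *m D2) *m x2 + G *m w ->
  ⟦x2 - x1⟧ <= L * ⟦D2 - D1⟧ * ⟦w⟧ /\
  ⟦(C + E *m D2) *m x2 - (C + E *m D1) *m x1⟧ <= L * ⟦D2 - D1⟧ * ⟦w⟧.
Proof.
have M20 : 0 <= 2 * M by rewrite mulr_ge0.
pose Lx := 2 * M * (⟦B⟧ * (2 * M * ⟦G⟧)).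
have Lx0 : 0 <= Lx by rewrite !mulr_ge0 ?frob_norm_ge0.
pose Lc := (⟦C⟧ + ⟦E⟧) * Lx + ⟦E⟧ * (2 * M * ⟦G⟧).
have Lc0 : 0 <= Lc by rewrite addr_ge0 ?mulr_ge0 ?addr_ge0 ?frob_norm_ge0.
exists (Lx + Lc) => [|D1 D2 aD1 aD2 m U x1 x2 w oU x1U x2U]; first exact: addr_ge0.
have [_ res1] := small_feedback_resolvent aD1; have [_ res2] := small_feedback_resolvent aD2.
have x2le : ⟦x2⟧ <= 2 * M * ⟦G⟧ * ⟦w⟧.
  by rewrite (le_trans (res2 _ _ _ _ oU x2U))// -(mulrA _ ⟦G⟧) ler_wpM2l// frob_normM.
have D2x : ⟦(D2 - D1) *m x2⟧ <= ⟦D2 - D1⟧ * (2 * M * ⟦G⟧ * ⟦w⟧) by exact: frob_normM_le.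
have dU : (x2 - x1) *m U = (F + B *m D1) *m (x2 - x1) + B *m ((D2 - D1) *m x2).
  rewrite mulmxBl x1U x2U mulmxBr mulmxBl mulmxBr !mulmxDl !mulmxA.
  by apply/matrixP => i j; rewrite ![in LHS]mxE ![in RHS]mxE; ring.
have dle : ⟦x2 - x1⟧ <= Lx * ⟦D2 - D1⟧ * ⟦w⟧.
  rewrite (le_trans (res1 _ _ _ _ oU dU))//.
  apply: (@le_trans _ _ (2 * M * (⟦B⟧ * (⟦D2 - D1⟧ * (2 * M * ⟦G⟧ * ⟦w⟧))))).
    by rewrite ler_wpM2l// frob_normM_le.
  by rewrite le_eqVlt; apply/orP; left; apply/eqP; rewrite /Lx; ring.
have w0 := frob_norm_ge0 w; have D0 := frob_norm_ge0 (D2 - D1).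
have Dw0 : 0 <= ⟦D2 - D1⟧ * ⟦w⟧ by exact: mulr_ge0.
split; first by rewrite (le_trans dle)// -!(mulrA _ ⟦D2 - D1⟧) ler_wpM2r// lerDl.
have -> : (C + E *m D2) *m x2 - (C + E *m D1) *m x1 =
    (C + E *m D1) *m (x2 - x1) + E *m ((D2 - D1) *m x2).
  rewrite mulmxBr mulmxBl mulmxBr !mulmxDl !mulmxA.
  by apply/matrixP => i j; rewrite ![in LHS]mxE ![in RHS]mxE; ring.
have CE : ⟦C + E *m D1⟧ <= ⟦C⟧ + ⟦E⟧.
  rewrite (le_trans (frob_normD _ _))// lerD2l (le_trans (frob_normM _ _))//.
  by rewrite ler_piMr ?frob_norm_ge0//; case: aD1.
rewrite (le_trans (frob_normD _ _))//.
apply: (@le_trans _ _ ((⟦C⟧ + ⟦E⟧) * (Lx * ⟦D2 - D1⟧ * ⟦w⟧) +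
    ⟦E⟧ * (⟦D2 - D1⟧ * (2 * M * ⟦G⟧ * ⟦w⟧)))).
  rewrite lerD ?frob_normM_le// (le_trans (frob_normM _ _))//.
  by rewrite ler_pM ?frob_norm_ge0.
have -> : (⟦C⟧ + ⟦E⟧) * (Lx * ⟦D2 - D1⟧ * ⟦w⟧) +
    ⟦E⟧ * (⟦D2 - D1⟧ * (2 * M * ⟦G⟧ * ⟦w⟧)) = Lc * (⟦D2 - D1⟧ * ⟦w⟧).
  by rewrite /Lc; ring.
by rewrite -(mulrA _ ⟦D2 - D1⟧) ler_wpM2r// lerDr.
Qed.

(** Exact for finite perturbations: the adjoint equation eliminates the state
    increment [x2 - x1] in favour of the increment of the fed-back input. *)
Lemma first_variation m (U : 'M[R]_m) x z D1 D2 x1 x2 w : orthogonalmx U ->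
  z = F^T *m (z *m U) + C^T *m (C *m x) ->
  x1 *m U = (F + B *m D1) *m x1 + G *m w -> x2 *m U = (F + B *m D2) *m x2 + G *m w ->
  ⟪C *m x, (C + E *m D2) *m x2 - (C + E *m D1) *m x1⟫ =
    ⟪input_gradient U x z, D2 *m x2 - D1 *m x1⟫.
Proof.
move=> oU zE x1U x2U; set Y := D2 *m x2 - D1 *m x1.
have -> : (C + E *m D2) *m x2 - (C + E *m D1) *m x1 = C *m (x2 - x1) + E *m Y.
  rewrite /Y !mulmxBr !mulmxDl !mulmxA.
  by apply/matrixP => i j; rewrite ![in LHS]mxE ![in RHS]mxE; ring.
have BY : B *m Y = (x2 - x1) *m U - F *m (x2 - x1).
  rewrite /Y mulmxBl x1U x2U !mulmxBr !mulmxDl !mulmxA.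
  by apply/matrixP => i j; rewrite ![in LHS]mxE ![in RHS]mxE; ring.
rewrite /input_gradient frob_innerDl frob_innerDr (frob_inner_mull E^T) (frob_inner_mull B^T).
rewrite !trmxK BY; congr (_ + _); move: (x2 - x1) => d.
rewrite frob_innerDr frob_innerNr frob_inner_ortho// {1}zE frob_innerDl.
have adj k1 k2 k3 (S : 'M[R]_(k1, k2)) (u : 'M[R]_(k1, k3)) v : ⟪S^T *m u, v⟫ = ⟪u, S *m v⟫.
  by rewrite frob_inner_mull trmxK.
by rewrite !adj addrAC subrr add0r.
Qed.

(** The derivative is taken with the trajectory [x] and the adjoint [z] of the
    unperturbed system, whereas the increment is between [D] and [D + t V]; the
    error must therefore be small with [D] as well as with [t]. *)
Lemma cost_expansion (V : 'M[R]_(nu, n)) : exists2 c, 0 <= c &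
  forall D t, 0 <= t -> small_feedback D -> small_feedback (D + t *: V) ->
  forall m (U : 'M[R]_m) x x1 x2 w z, orthogonalmx U -> ⟦w⟧ = 1 ->
  x *m U = F *m x + G *m w -> z = F^T *m (z *m U) + C^T *m (C *m x) ->
  x1 *m U = (F + B *m D) *m x1 + G *m w ->
  x2 *m U = (F + B *m (D + t *: V)) *m x2 + G *m w ->
  ⟦(C + E *m (D + t *: V)) *m x2⟧ ^+ 2 <= ⟦(C + E *m D) *m x1⟧ ^+ 2 +
    t * (2 * ⟪input_gradient U x z, V *m x⟫) + t * (c * (⟦D⟧ + t)).
Proof.
have [H H0 hle] := input_gradient_bounded; have [L L0 lip] := response_lipschitz.
have adm0 : small_feedback 0 by rewrite /small_feedback frob_norm0 mulr0; split; lra.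
pose v := ⟦V⟧; have v0 : 0 <= v := frob_norm_ge0 V.
pose K := 4 * H * v * L + 2 * L * L * v.
exists (K * (1 + v)) => [|D t t0 aD aDt m U x x1 x2 w z oU w1 xU zE x1U x2U].
  by rewrite /K !(mulr_ge0, addr_ge0)//.
set h := input_gradient U x z.
have hH : ⟦h⟧ <= H := hle _ _ _ _ _ oU xU zE w1.
have x0U : x *m U = (F + B *m 0) *m x + G *m w by rewrite mulmx0 addr0.
have := lip _ _ adm0 aD _ _ _ _ _ oU x0U x1U.
have := lip _ _ adm0 aDt _ _ _ _ _ oU x0U x2U.
have := lip _ _ aD aDt _ _ _ _ _ oU x1U x2U.
rewrite !subr0 mulmx0 addr0 (addrC D) addrK w1 !mulr1 frob_normZ ger0_norm// -/v.
rewrite (addrC _ D).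
set c1 := (C + E *m D) *m x1; set c2 := (C + E *m (D + t *: V)) *m x2.
move=> -[d21 c21] [d20 c20] [d10 c10].
have Dt : ⟦D + t *: V⟧ <= ⟦D⟧ + t * v.
  by rewrite (le_trans (frob_normD _ _))// frob_normZ ger0_norm.
have var : ⟪C *m x, c2 - c1⟫ =
    t * ⟪h, V *m x⟫ + (t * ⟪h, V *m (x2 - x)⟫ + ⟪h, D *m (x2 - x1)⟫).
  rewrite (first_variation oU zE x1U x2U) -/h.
  have -> : (D + t *: V) *m x2 - D *m x1 =
      t *: (V *m x) + (t *: (V *m (x2 - x)) + D *m (x2 - x1)).
    rewrite !mulmxBr mulmxDl -scalemxAl.
    by apply/matrixP => i j; rewrite ![in LHS]mxE ![in RHS]mxE; ring.
  by rewrite !frob_innerDr !frob_innerZr.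
(* The difference of squares is polarized around the unperturbed output [C x], to
   which [first_variation] applies. *)
have polar : ⟦c2⟧ ^+ 2 = ⟦c1⟧ ^+ 2 + 2 * ⟪C *m x, c2 - c1⟫
    + ⟪c2 - c1, (c2 - C *m x) + (c1 - C *m x)⟫.
  by rewrite !frob_normK !frob_innerL (frob_innerC c1 c2) (frob_innerC c2 (C *m x))
    (frob_innerC c1 (C *m x)); ring.
have D0 := frob_norm_ge0 D.
have cs k1 k2 (a b : 'M[R]_(k1, k2)) p1 p2 : ⟦a⟧ <= p1 -> ⟦b⟧ <= p2 -> ⟪a, b⟫ <= p1 * p2.
  by move=> ap bp; rewrite (le_trans (frob_inner_le _ _))// ler_pM ?frob_norm_ge0.
have T1 : ⟪h, V *m (x2 - x)⟫ <= H * (v * (L * (⟦D⟧ + t * v))).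
  apply: cs => //; apply: frob_normM_le; rewrite (le_trans d20)//.
  by rewrite ler_wpM2l.
have T2 : ⟪h, D *m (x2 - x1)⟫ <= H * (⟦D⟧ * (L * (t * v))).
  by apply: cs => //; apply: frob_normM_le.
have T3 : ⟪c2 - c1, (c2 - C *m x) + (c1 - C *m x)⟫ <=
    L * (t * v) * (L * (⟦D⟧ + t * v) + L * ⟦D⟧).
  apply: cs => //; rewrite (le_trans (frob_normD _ _))// lerD//.
  by rewrite (le_trans c20)// ler_wpM2l.
have T1t := ler_wpM2l t0 T1.
rewrite polar var.
have : 2 * (t * (H * (v * (L * (⟦D⟧ + t * v))))) + 2 * (H * (⟦D⟧ * (L * (t * v))))
   + L * (t * v) * (L * (⟦D⟧ + t * v) + L * ⟦D⟧) <= t * (K * (1 + v) * (⟦D⟧ + t)).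
  rewrite -subr_ge0 (_ : _ - _ =
      t * ((2 * H * L * v + L * L * v) * (2 * t + 2 * v * ⟦D⟧ + t * v))).
    by rewrite !(mulr_ge0, addr_ge0).
  rewrite /K; ring.
lra.
Qed.

End Descent.

(** * Uniform descent of the cost *)

Section UniformDescent.
Context {R : realType}.

Lemma gain_unit n p q (F : 'M[R]_n) (G : 'M[R]_(n, p)) (C : 'M[R]_(q, n)) M l :
  resolvent_bound F M ->
  (forall m (U : 'M[R]_m) x w, orthogonalmx U -> x *m U = F *m x + G *m w ->
     ⟦w⟧ = 1 -> ⟦C *m x⟧ ^+ 2 <= l) ->
  gain F G C l.
Proof.
move=> [M0 resF] unitF m U x w oU xU.
have [w0|w0] := eqVneq ⟦w⟧ 0.
  have := resF _ _ _ _ oU xU; rewrite (frob_norm_eq0 w0) mulmx0 !frob_norm0 mulr0 => x0.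
  have /frob_norm_eq0 -> : ⟦x⟧ = 0 by apply/eqP; rewrite eq_le x0 frob_norm_ge0.
  by rewrite mulmx0 frob_norm0 expr0n mulr0.
have w_gt0 : 0 < ⟦w⟧ by rewrite lt_def w0 frob_norm_ge0.
have := unitF _ _ (⟦w⟧^-1 *: x) (⟦w⟧^-1 *: w) oU.
rewrite -scalemxAl -!scalemxAr -scalerDr -xU !frob_normZ ger0_norm ?invr_ge0 ?frob_norm_ge0//.
rewrite mulVf// => /(_ erefl erefl); rewrite exprMn exprVn mulrC ler_pdivrMr//.
by rewrite exprn_gt0.
Qed.

Lemma exists_small (s : seq R) : {in s, forall k, 0 <= k} ->
  exists2 d, 0 < d & {in s, forall k, k * d <= 1}.
Proof.
move=> s0; have sum0 (r : seq R) : {in r, forall k, 0 <= k} -> 0 <= \sum_(k <- r) k.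
  by move=> r0; rewrite big_seq sumr_ge0.
have d_gt0 : 0 < 1 + \sum_(k <- s) k by rewrite ltr_wpDr// sum0.
exists (1 + \sum_(k <- s) k)^-1; first by rewrite invr_gt0.
move=> k ks; rewrite ler_pdivrMr// mul1r (big_rem k)//= addrCA lerDl.
by rewrite addr_ge0// sum0// => j /mem_rem/s0.
Qed.

Lemma half_bound (k u d : R) : 0 < u -> 2 * k / u * d <= 1 -> k * d <= u / 2.
Proof. by move=> u0; rewrite mulrAC ler_pdivrMr//; lra. Qed.

(** The arithmetic of the descent, with [n0] and [n1] the output norms at [K] and at
    [K + D], [J1] the cost at [K + D], [g] the cost at [K], and [phi2] the squared
    output norm after the step [t]. The loss [t * kappa * (g^2 - n0^2)] is compared
    with [J1^2 - n1^2], of which it is at most a fraction since [t * kappa <= 1]. *)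
Lemma descent_budget (kappa a c e L g d D t J1 n0 n1 phi2 r : R) :
  0 <= kappa -> 0 <= c -> 0 <= L -> 0 <= e -> 0 <= g -> 0 <= D -> D <= d -> 0 <= t -> t <= d ->
  kappa * d <= 1 -> L * d <= 1 ->
  (2 * kappa * L * (2 * g + 3) + 2 * c) * d <= a / 2 -> e * (4 * (g + 1)) = a ->
  J1 <= g + L * D -> g <= J1 + L * D ->
  0 <= n0 -> 0 <= n1 -> n0 <= g -> n1 <= J1 -> n1 <= n0 + L * D ->
  r <= - a + kappa * (g ^+ 2 - n0 ^+ 2) ->
  phi2 <= n1 ^+ 2 + t * r + t * (c * (D + t)) ->
  phi2 <= (J1 - e * t) ^+ 2.
Proof.
move=> kappa0 c0 L0 e0 g0 D0 Dd t0 td kd Ld err_d eE J1_le J1_ge n00 n10 n0g n1J n1_le r_le phi2_le.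
pose S := 2 * g + 3; have S0 : 0 <= S by rewrite addr_ge0// mulr_ge0.
have LDd : L * D <= L * d by exact: ler_wpM2l.
have LD0 : 0 <= L * D by exact: mulr_ge0.
have sqr_le (u v : R) : 0 <= u -> u <= v -> u ^+ 2 <= v ^+ 2.
  by move=> u0 uv; rewrite !expr2 ler_pM.
move yE : (L * D) LDd LD0 J1_le J1_ge n1_le => y yLd y0 J1_le J1_ge n1_le.
have y1 : y <= 1 by exact: le_trans yLd Ld.
have yy : y * y <= y by exact: ler_piMl.
have J10 : 0 <= J1 by exact: le_trans n1J.
have phi1 : n1 ^+ 2 <= n0 ^+ 2 + S * y.
  have := sqr_le _ _ n10 n1_le.
  have : n0 * y <= g * y by rewrite ler_wpM2r.
  rewrite /S; lra.
have g2J : g ^+ 2 <= J1 ^+ 2 + S * y.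
  have := sqr_le _ _ g0 J1_ge.
  have : J1 * y <= (g + 1) * y by rewrite ler_wpM2r//; lra.
  rewrite /S; lra.
have eta : kappa * (g ^+ 2 - n0 ^+ 2) <= kappa * (J1 ^+ 2 - n1 ^+ 2 + 2 * (S * y)).
  by rewrite ler_wpM2l//; lra.
have kt : t * (kappa * (J1 ^+ 2 - n1 ^+ 2)) <= J1 ^+ 2 - n1 ^+ 2.
  rewrite mulrA ler_piMl ?subr_ge0 ?sqr_le//; apply: le_trans kd.
  by rewrite mulrC ler_wpM2l.
have err : kappa * (2 * (S * y)) + c * (D + t) <= a / 2.
  apply: le_trans err_d; rewrite -/S.
  have : c * (D + t) <= c * (d + d) by rewrite ler_wpM2l// lerD.
  have : kappa * (2 * S) * y <= kappa * (2 * S) * (L * d).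
    by rewrite ler_wpM2l// mulr_ge0// mulr_ge0.
  lra.
have := ler_wpM2l t0 err; have := ler_wpM2l t0 eta; have := ler_wpM2l t0 r_le.
have J1g : e * t * J1 <= e * t * (g + 1) by rewrite ler_wpM2l ?mulr_ge0//; lra.
have : t * (e * (4 * (g + 1))) = t * a by rewrite eE.
have := sqr_ge0 (e * t); rewrite sqrrB; lra.
Qed.

Context {nx nu nw : nat}.
Variables (A : 'M[R]_nx) (B : 'M[R]_(nx, nu)) (Bw : 'M[R]_(nx, nw)).
Variables (Q : 'M[R]_nx) (Ru : 'M[R]_nu).
Local Notation J := (Hinf_cost A B Bw Q Ru).
Local Notation E := (col_mx 0 (sqrtmx Ru) : 'M[R]_(nx + nu, nu)).

Lemma closed_loopD K D : closed_loop A B (K + D) = closed_loop A B K + B *m D.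
Proof. by rewrite /closed_loop mulmxDr addrA. Qed.

Lemma output_mxD K D : output_mx Q Ru (K + D) = output_mx Q Ru K + E *m D.
Proof. by rewrite /output_mx mul_col_mx mul0mx add_col_mx addr0 mulmxDr. Qed.

Lemma Hinf_lipschitz K M : resolvent_bound (closed_loop A B K) M ->
  exists2 L, 0 <= L & forall D1 D2, small_feedback B M D1 -> small_feedback B M D2 ->
    J (K + D2) <= J (K + D1) + L * ⟦D2 - D1⟧.
Proof.
move=> resK; have [L L0 lip] := response_lipschitz B Bw (output_mx Q Ru K) E resK.
exists L => // D1 D2 aD1 aD2.
have [res1 res2] := (small_feedback_resolvent resK aD1, small_feedback_resolvent resK aD2).
rewrite -!closed_loopD in res1 res2.
have LD0 : 0 <= L * ⟦D2 - D1⟧ by rewrite mulr_ge0// frob_norm_ge0.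
apply: (Hinf_cost_le res2); first by rewrite addr_ge0// Hinf_cost_ge0.
apply: (gain_unit res2) => m U x2 w oU x2U w1.
have [x1 x1U] := resolvent_solve (Bw *m w) res1 oU.
have := Hinf_cost_gain Q Ru res1 oU x1U; rewrite w1 expr1n mulr1 => c1.
have [_] : _ /\ _ := lip _ _ aD1 aD2 _ _ _ _ _ oU
  (etrans x1U (congr1 (fun F => F *m x1 + _) (closed_loopD K D1)))
  (etrans x2U (congr1 (fun F => F *m x2 + _) (closed_loopD K D2))).
rewrite -!output_mxD w1 mulr1 => c21.
have J0 : 0 <= J (K + D1) by exact: Hinf_cost_ge0.
rewrite ler_sqr ?nnegrE ?addr_ge0 ?frob_norm_ge0//.
rewrite -[_ *m x2](subrK (output_mx Q Ru (K + D1) *m x1)) addrC.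
rewrite (le_trans (frob_normD _ _))// lerD//.
by move: c1; rewrite ler_sqr ?nnegrE ?frob_norm_ge0.
Qed.

(** The decrease rate is the same for all gains [K + D] near [K], as Clarke's
    derivative requires. *)
Lemma uniform_descent K Ks : row_free Bw ->
  stabilizing_gains A B K -> stabilizing_gains A B Ks -> J Ks < J K ->
  exists V c d, [/\ 0 < c, 0 < d &
    forall D t, ⟦D⟧ <= d -> 0 < t -> t <= d -> J (K + D + t *: V) <= J (K + D) - c * t].
Proof.
move=> /row_freeP[Bi BwBi] stK stKs; move gE : (J K) => g JKs.
have [M resK] := stable_resolvent stK; have [Ms resKs] := stable_resolvent stKs.
rewrite -/(closed_loop A B K) in resK; rewrite -/(closed_loop A B Ks) in resKs.
set F := closed_loop A B K in resK *.
set C := output_mx Q Ru K.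
have Js0 : 0 <= J Ks by exact: Hinf_cost_ge0.
have g_gt0 : 0 < g by exact: le_lt_trans JKs.
have gainK := Hinf_cost_gain (Bw := Bw) Q Ru resK; rewrite gE -/F -/C in gainK.
have [P [PT primal]] := bounded_real gainK BwBi (sqr_ge0 g).
have sqr_lt : J Ks ^+ 2 < g ^+ 2.
  by rewrite !expr2 ltr_pM.
have [X [l [XT X_ge0 l0 l_lt dual]]] := dual_storage resKs
  (stable_power_decay stKs) (sqr_ge0 _) sqr_lt (Hinf_cost_gain Q Ru resKs).
pose Ds := Ks - K; have KsE : Ks = K + Ds by rewrite /Ds addrC subrK.
rewrite KsE closed_loopD output_mxD in dual.
have [kappa kappa0 rate] := descent_rate resK PT XT X_ge0 l0 l_lt primal dual.
set V := Ds *m X *m P in rate.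
have [c c0 expansion] := cost_expansion B Bw C E resK V.
have [L1 L10 lip] := response_lipschitz B Bw C E resK.
have [L2 L20 Jlip] := Hinf_lipschitz resK.
pose L := L1 + L2; have L0 : 0 <= L by exact: addr_ge0.
pose a := g ^+ 2 * (g ^+ 2 - l) / 2.
have a_gt0 : 0 < a by rewrite divr_gt0// mulr_gt0 ?subr_gt0// exprn_gt0.
(* Passing from squared costs to costs divides the rate by twice the cost, and
   [g + 1] bounds the cost near [K]. *)
pose e := a / (4 * (g + 1)).
have g1_gt0 : 0 < g + 1 by rewrite addr_gt0.
have e_gt0 : 0 < e by rewrite divr_gt0// mulr_gt0.
have M0 : 0 <= M by case: resK.
have [v0 b0] := (frob_norm_ge0 V, frob_norm_ge0 B).
have [|d d_gt0 small] := @exists_small [:: 2 * (M * ⟦B⟧ * (1 + ⟦V⟧)); 1 + ⟦V⟧; kappa; L;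
    2 * L / g; 2 * (2 * kappa * L * (2 * g + 3) + 2 * c) / a; 2 * e / g].
  have [g0 a0 e0] := And3 (ltW g_gt0) (ltW a_gt0) (ltW e_gt0).
  clearbody e a L.
  by move=> k; rewrite !inE => /or4P[| | |/or4P[| | |]] /eqP ->;
    rewrite ?(divr_ge0, mulr_ge0, addr_ge0).
have s1 : 2 * (M * ⟦B⟧ * (1 + ⟦V⟧)) * d <= 1 by apply: small; rewrite !inE eqxx ?orbT.
have s2 : (1 + ⟦V⟧) * d <= 1 by apply: small; rewrite !inE eqxx ?orbT.
have s3 : kappa * d <= 1 by apply: small; rewrite !inE eqxx ?orbT.
have s4 : L * d <= 1 by apply: small; rewrite !inE eqxx ?orbT.
have s5 : L * d <= g / 2.
  by apply: half_bound g_gt0 _; apply: small; rewrite !inE eqxx ?orbT.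
have s6 : (2 * kappa * L * (2 * g + 3) + 2 * c) * d <= a / 2.
  by apply: half_bound a_gt0 _; apply: small; rewrite !inE eqxx ?orbT.
have s7 : e * d <= g / 2.
  by apply: half_bound g_gt0 _; apply: small; rewrite !inE eqxx ?orbT.
exists V, e, d; split=> // D t Dd t_gt0 td; have t0 := ltW t_gt0.
have D0 := frob_norm_ge0 D.
have adm D' : ⟦D'⟧ <= (1 + ⟦V⟧) * d -> small_feedback B M D'.
  move=> D'd; split; last exact: le_trans s2.
  by have := ler_wpM2l (mulr_ge0 M0 b0) D'd; clear -s1; lra.
have aD : small_feedback B M D.
  by apply: adm; rewrite (le_trans Dd)// mulrDl mul1r lerDl mulr_ge0// ltW.
have Dt : ⟦D + t *: V⟧ <= (1 + ⟦V⟧) * d.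
  rewrite (le_trans (frob_normD _ _))// frob_normZ ger0_norm// mulrDl mul1r.
  by rewrite lerD// mulrC ler_wpM2l.
have aDt := adm _ Dt.
have a0 : small_feedback B M 0 by apply: adm; rewrite frob_norm0 mulr_ge0 ?addr_ge0// ltW.
have resD := small_feedback_resolvent resK aD; have resDt := small_feedback_resolvent resK aDt.
have J10 : 0 <= J (K + D) by exact: Hinf_cost_ge0.
move J1E : (J (K + D)) J10 => J1 J10.
have LD : L * ⟦D⟧ <= L * d by rewrite ler_wpM2l.
have L2D : L2 * ⟦D⟧ <= L * ⟦D⟧ by rewrite ler_wpM2r// lerDr.
have L1D : L1 * ⟦D⟧ <= L * ⟦D⟧ by rewrite ler_wpM2r// lerDl.
have J1_le : J1 <= g + L * ⟦D⟧.
  by have := Jlip _ _ a0 aD; rewrite addr0 subr0 gE J1E; clear -L2D; lra.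
have J1_ge : g <= J1 + L * ⟦D⟧.
  by have := Jlip _ _ aD a0; rewrite addr0 sub0r frob_normN gE J1E; clear -L2D; lra.
have eE : e * (4 * (g + 1)) = a by rewrite divfK// gt_eqF// mulr_gt0.
have et : e * t <= e * d by rewrite ler_wpM2l// ltW.
rewrite -addrA; have resDt' := resDt; rewrite -closed_loopD in resDt'.
apply: (Hinf_cost_le resDt'); first by clear -J1_ge LD s5 et s7; lra.
apply: (gain_unit resDt') => m U x2 w oU x2U w1.
rewrite closed_loopD in x2U; rewrite output_mxD.
have [x1 x1U] := resolvent_solve (Bw *m w) resD oU.
have [x xU] := resolvent_solve (Bw *m w) resK oU.
have [z zU] := resolvent_solve (C^T *m (C *m x) *m U^T)
  (resolvent_bound_tr resK) (orthogonalmx_tr oU).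
have zE : z = F^T *m (z *m U) + C^T *m (C *m x).
  by rewrite -{1}(orthogonalmxKl z oU) zU mulmxDl -mulmxA orthogonalmxKl.
have := expansion _ _ t0 aD aDt _ _ _ _ _ _ _ oU w1 xU zE x1U x2U.
have := rate _ _ _ _ _ oU xU zE w1; rewrite -/V -/a.
have := gainK _ _ _ _ oU xU; rewrite w1 expr1n mulr1.
have resD' := resD; rewrite -closed_loopD in resD'.
have x1U' := x1U; rewrite -closed_loopD in x1U'.
have := Hinf_cost_gain Q Ru resD' oU x1U'; rewrite w1 expr1n mulr1 J1E output_mxD -/C.
have x0U : x *m U = (F + B *m 0) *m x + Bw *m w by rewrite mulmx0 addr0.
have [_] := lip _ _ a0 aD _ _ _ _ _ oU x0U x1U.
rewrite mulmx0 addr0 subr0 w1 mulr1.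
set h := input_gradient _ _ _ _ _ _; set c0' := C *m x; set c1 := (C + _) *m x1.
set c2 := (C + _) *m x2; move=> c10 c1J cg rate_h expand.
have n0 := frob_norm_ge0 c0'; have n1 := frob_norm_ge0 c1.
have c0g : ⟦c0'⟧ <= g by move: cg; rewrite ler_sqr ?nnegrE// ltW.
have c1_le : ⟦c1⟧ <= ⟦c0'⟧ + L * ⟦D⟧.
  rewrite -[c1](subrK c0') addrC (le_trans (frob_normD _ _))// lerD2l.
  exact: le_trans L1D.
have LD0 : 0 <= L * ⟦D⟧ by exact: mulr_ge0.
apply: (descent_budget kappa0 c0 L0 (ltW e_gt0) (ltW g_gt0) D0 Dd t0 td s3 s4 s6 eE
  J1_le J1_ge n0 n1 c0g _ c1_le rate_h expand).
by move: c1J; rewrite ler_sqr ?nnegrE.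
Qed.

End UniformDescent.

(** * Clarke subgradients *)

Section Clarke.
Context {R : realType}.

(** The topology of matrices is that of the entrywise maximum, so the radius is
    divided by a bound on the square root of the number of entries. *)
Lemma nbhs_frob_ball m n (X : 'M[R]_(m, n)) d : 0 < d ->
  nbhs X [set Y | ⟦Y - X⟧ <= d].
Proof.
move=> d0; pose N : R := m%:R * n%:R + 1.
have N0 : 0 < N by rewrite ltr_wpDl// mulr_ge0.
apply/nbhs_ballP; exists (d / N); first by rewrite /= divr_gt0.
move=> Y [_ XY] /=; rewrite -ler_sqr ?nnegrE ?frob_norm_ge0 ?(ltW d0)//.
rewrite frob_normK frob_innerE.
apply: (@le_trans _ _ (\sum_(j < n) \sum_(i < m) (d / N) ^+ 2)).
  apply: ler_sum => j _; apply: ler_sum => i _; rewrite -expr2 !mxE.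
  have := XY i j; rewrite /ball/= distrC => /ltW.
  rewrite -real_normK ?num_real// => le; rewrite ler_sqr ?nnegrE//.
  by rewrite divr_ge0// ltW.
rewrite !sumr_const !card_ord -mulrnA -[leLHS]mulr_natl natrM.
rewrite expr_div_n mulrA ler_pdivrMr ?exprn_gt0// mulrC ler_wpM2l ?sqr_ge0//.
have : 0 <= m%:R * n%:R :> R by rewrite mulr_ge0.
rewrite /N; move: (m%:R * n%:R) => x x0; nra.
Qed.

Lemma clarke_derivative_le m n (f : 'M[R]_(m, n) -> R) X V c d : 0 < d ->
  (forall D t, ⟦D⟧ <= d -> 0 < t -> t <= d -> f (X + D + t *: V) <= f (X + D) - c * t) ->
  (clarke_derivative f X V <= (- c)%:E)%E.
Proof.
move=> d0 fd; rewrite /clarke_derivative limf_esupE.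
pose W := [set p : 'M[R]_(m, n) * R | ⟦p.1 - X⟧ <= d /\ 0 < p.2 <= d].
apply: ge_ereal_inf.
exists (ereal_sup ((fun p => ((f (p.1 + p.2 *: V) - f p.1) / p.2)%:E) @` W)).
  exists W => //; exists ([set Y | ⟦Y - X⟧ <= d], [set t | 0 < t <= d]); last first.
    by move=> [Y t] [].
  split; first exact: nbhs_frob_ball.
  near=> t => /=; apply/andP; split; near: t; [exact: nbhs_right_gt|exact: nbhs_right_le].
apply: ge_ereal_sup => _ [[Y t] [/= YX /andP[t0 td]] <-].
rewrite lee_fin ler_pdivrMr// mulNr lerBlDl.
by have := fd _ _ YX t0 td; rewrite (addrC X) subrK.
Unshelve. all: by end_near.
Qed.

End Clarke.

Theorem theorem2 (R : realType) (nx nu nw : nat)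
    (A : 'M[R]_nx) (B : 'M[R]_(nx, nu)) (Bw : 'M[R]_(nx, nw))
    (Q : 'M[R]_nx) (Ru : 'M[R]_nu)
    (stabAB : stabilizable A B)
    (Bw_full_row_rank : row_free Bw)
    (Q_pos : posdefmx Q) (Ru_pos : posdefmx Ru)
    (gains_nonempty : stabilizing_gains A B !=set0) :
  forall K : 'M[R]_(nu, nx), stabilizing_gains A B K ->
  exists mu : R, 0 < mu /\
    ((mu * (Hinf_cost A B Bw Q Ru K - Hinf_opt A B Bw Q Ru))%:E
       <= frob_dist0 (clarke_subdifferential (Hinf_cost A B Bw Q Ru) K))%E.
Proof.
move=> K stK; set J := Hinf_cost A B Bw Q Ru.
have [JK|JK] := leP (J K) (Hinf_opt A B Bw Q Ru).
  exists 1; split=> //; apply: le_ereal_inf_tmp => _ [G _ <-].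
  by rewrite lee_fin mul1r (le_trans _ (frob_norm_ge0 G))// subr_le0.
have [_ [Ks stKs <-] JKs] := inf_lt (image_nonempty _ gains_nonempty) JK.
have [V [c [d [c0 d0 descent]]]] := uniform_descent Bw_full_row_rank stK stKs JKs.
have gap : 0 < J K - Hinf_opt A B Bw Q Ru by rewrite subr_gt0.
have V1 : 0 < ⟦V⟧ + 1 by rewrite ltr_wpDl// frob_norm_ge0.
exists (c / ((⟦V⟧ + 1) * (J K - Hinf_opt A B Bw Q Ru))).
split; first by rewrite divr_gt0// mulr_gt0.
apply: le_ereal_inf_tmp => _ [G /(_ V) subG <-]; rewrite lee_fin.
have := le_trans subG (clarke_derivative_le d0 descent); rewrite lee_fin => GV.
rewrite invfM mulrA mulfVK ?gt_eqF// ler_pdivrMr//.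
have := frob_inner_abs G V; rewrite ler_norml => /andP[+ _] => lo.
have := frob_norm_ge0 G; lra.
Qed.
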